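(* Let $d, m \in \mathbb{N}$ with $d \ge 2$ and $m \ge 2$. Let $C \in \mathcal{K}_o^d(2m-1)$, i.e. $C$ is an origin-symmetric convex body in $\mathbb{R}^d$ with exactly $2m-1$ points of $\mathbb{Z}^d$ in its interior. Then $\operatorname{vol}(C) = m 2^d$ if and only if $C$ is a cylindrical $m$-lifting of a $(d-1)$-dimensional extremal convex body.
   Context: $\mathbb{N}=\{1,2,3,\ldots\}$. A convex body in $\mathbb{R}^d$ is a compact convex subset of $\mathbb{R}^d$ of dimension $d$ (equivalently, with non-empty interior). $\mathcal{K}_o^d$ is the family of convex bodies in $\mathbb{R}^d$ that are centrally symmetric with respect to the origin, and for $m \in \mathbb{N}$, $\mathcal{K}_o^d(2m-1)$ is the family of those $K \in \mathcal{K}_o^d$ having exactly $2m-1$ points of $\mathbb{Z}^d$ in their interior. $\operatorname{vol}$ is Lebesgue measure. Extremal: for $n\in\mathbb{N}$, an $n$-dimensional extremal convex body is a set $B \in \mathcal{K}_o^n(1)$ (so the origin is its only interior lattice point) with $\operatorname{vol}(B) = 2^n$. Cylindrical lifting: for $d \ge 2$, a set $B \subseteq \mathbb{R}^{d-1}$ and functions $f,g : \mathbb{R}^{d-1} \to \mathbb{R}$, let $L(B,f,g) := \{(y,t) \in B \times \mathbb{R} : f(y) \le t \le g(y)\}$. A unimodular transformation is an affine transformation $\phi:\mathbb{R}^d\to\mathbb{R}^d$ with $\phi(\mathbb{Z}^d)=\mathbb{Z}^d$. For $C \in \mathcal{K}_o^d$ and $B \in \mathcal{K}_o^{d-1}$,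 $C$ is a cylindrical $m$-lifting of $B$ if $C = \phi(L(B,a-m,a+m))$ for some linear unimodular transformation $\phi:\mathbb{R}^d \to \mathbb{R}^d$ and some linear function $a : \mathbb{R}^{d-1} \to \mathbb{R}$. *)

(* Defs.v *)
From HB Require Import structures.
From mathcomp Require Export all_boot all_order all_algebra.
From mathcomp Require Export all_classical all_reals all_analysis.

Set Implicit Arguments.
Unset Strict Implicit.
Unset Printing Implicit Defensive.

Import Order.TTheory GRing.Theory Num.Theory.
Export numFieldNormedType.Exports.

Local Open Scope classical_set_scope.
Local Open Scope ring_scope.

Section SigmaFinite.
Context d1 (T1 : measurableType d1) (R : realType).
Variables (p : {measure set T1 -> \bar R}) (sf : sigma_finite setT p).

Let q : set T1 -> \bar R := p.
HB.instance Definition _ := Measure.on q.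
HB.instance Definition _ := Measure_isSigmaFinite.Build _ _ _ q sf.

Lemma sigma_finite_measureP :
  exists nu : {sigma_finite_measure set T1 -> \bar R},
    (p : set T1 -> \bar R) = nu.
Proof. by exists q. Qed.

End SigmaFinite.

(* The library's sigma-finite instance on [m1 \x m2] is shadowed by its later
   subprobability instance. *)
Lemma product_sigma_finite d1 d2 (T1 : measurableType d1)
    (T2 : measurableType d2) (R : realType)
    (m1 : {sigma_finite_measure set T1 -> \bar R})
    (m2 : {sigma_finite_measure set T2 -> \bar R}) :
  exists nu : {sigma_finite_measure set (T1 * T2)%type -> \bar R},
    (m1 \x m2)%E = nu.
Proof.
apply: sigma_finite_measureP.
have /sigma_finiteP[F [TF ndF Foo]] := sigma_finiteT m1.
have /sigma_finiteP[G [TG ndG Goo]] := sigma_finiteT m2.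
exists (fun n => F n `*` G n).
  rewrite -setXTT TF TG predeqE => -[x y]; split.
    move=> [/= [n _ Fnx] [k _ Gky]]; exists (maxn n k) => //; split.
    - by move: x Fnx; exact/subsetPset/ndF/leq_maxl.
    - by move: y Gky; exact/subsetPset/ndG/leq_maxr.
  by move=> [n _ []/= ? ?]; split; exists n.
move=> k; have [? ?] := Foo k; have [? ?] := Goo k.
split; first exact: measurableX.
by rewrite /= product_measure1E// lte_mul_pinfty// ge0_fin_numE.
Qed.

Section Volume.
Variable R : realType.

(* The n-fold product of the Lebesgue measure of R, with a Dirac mass on R^0:
   by [lebesgue_tuple_measure] and [lebesgue_tuple_box] it is the
   sigma-finite Borel measure that gives a box the product of its sides. *)
Fixpoint lebesgue_tuple (n : nat) :
    set (n.-tuple (measurableTypeR R)) -> \bar R :=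
  match n with
  | 0 => @dirac _ (0.-tuple (measurableTypeR R)) [tuple] R
  | k.+1 => pushforward (@lebesgue_measure R \x lebesgue_tuple (n := k))%E
              (fun p : measurableTypeR R * k.-tuple (measurableTypeR R) =>
                 [tuple of p.1 :: p.2])
  end.

Definition vol (d : nat) (A : set 'rV[R]_d) : \bar R :=
  lebesgue_tuple [set t | A (\row_i tnth t i)].

Lemma pushforward_sigma_finite d1 d2 (T1 : measurableType d1)
    (T2 : measurableType d2) (m : {sigma_finite_measure set T1 -> \bar R})
    (f : T1 -> T2) (g : T2 -> T1) : cancel f g ->
  measurable_fun setT f -> measurable_fun setT g ->
  exists nu : {sigma_finite_measure set T2 -> \bar R}, pushforward m f = nu.
Proof.
move=> fK mf mg.
pose p := measure_function_pushforward__canonical__measure_function_Measure m mf.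
have sf : sigma_finite setT p.
  have [G TG Goo] := @sigma_finiteT _ _ _ m.
  exists (fun i => g @^-1` G i).
    by rewrite -preimage_bigcup -TG preimage_setT.
  move=> i; have [mG Gi] := Goo i; split.
    by rewrite -[X in measurable X]setTI; exact: mg.
  rewrite /p /= /pushforward -comp_preimage (_ : g \o f = id) //.
  exact/funext.
exact: sigma_finite_measureP sf.
Qed.

Lemma lebesgue_tuple_measure (n : nat) :
  exists mu : {sigma_finite_measure set (n.-tuple (measurableTypeR R))
                 -> \bar R}, lebesgue_tuple (n := n) = mu.
Proof.
elim: n => [|n [mu IH]] /=.
  by exists (@dirac _ (0.-tuple (measurableTypeR R)) [tuple] R).
rewrite {}IH.
have fK : cancel
    (fun p : measurableTypeR R * n.-tuple (measurableTypeR R) =>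
       [tuple of p.1 :: p.2])
    (fun t => (thead t, [tuple of behead t])).
  by move=> [x t]; rewrite theadE; congr pair; exact/val_inj.
have [nu ->] := product_sigma_finite (@lebesgue_measure R) mu.
apply: (pushforward_sigma_finite nu fK).
- exact: measurable_cons measurable_fst measurable_snd.
- apply/measurable_fun_pair => /=; first exact: measurable_tnth.
  exact: measurable_behead.
Qed.

Lemma lebesgue_tuple_box (n : nat) (a b : 'I_n -> R) :
  (forall i, a i <= b i) ->
  lebesgue_tuple [set t | forall i, tnth t i \in `[a i, b i]] =
  (\prod_(i < n) (b i - a i))%:E.
Proof.
elim: n a b => [|n IH] a b ab.
  by rewrite /= big_ord0 diracE mem_set// => -[].
have [mu muE] := lebesgue_tuple_measure n.
rewrite /= /pushforward big_ord_recl EFinM.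
set B := [set t : n.-tuple (measurableTypeR R) |
  forall i, tnth t i \in `[a (lift ord0 i), b (lift ord0 i)]].
have mB : measurable B.
  rewrite (_ : B = \bigcap_(i in [set: 'I_n])
      (fun t => tnth t i) @^-1` `[a (lift ord0 i), b (lift ord0 i)]%classic).
    apply: fin_bigcap_measurable => [|i _]; first exact: finite_finset.
    by rewrite -[X in measurable X]setTI; exact: measurable_tnth.
  by rewrite predeqE => t; split => [tB i _|tB i]; [exact: tB|exact: (tB i I)].
rewrite [X in (_ \x _)%E X](_ : _ = `[a ord0, b ord0]%classic `*` B); last first.
  rewrite predeqE => -[x t]; split => /=.
    move=> H; split; first exact: (H ord0).
    by move=> i; have := H (lift ord0 i); rewrite tnthS.
  move=> [xab tB] i; case: (unliftP ord0 i) => [j|] ->; last exact: xab.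
  by rewrite tnthS; exact: tB.
rewrite muE product_measure1E //.
rewrite -muE IH //; congr (_ * _)%E.
apply: etrans (@lebesgue_measure_itv R `[a ord0, b ord0]) _.
rewrite /= lte_fin.
case: ltP => // ba.
by rewrite (@le_anti _ _ (a ord0) (b ord0)) ?ab// subrr.
Qed.

End Volume.

Section Lifting.
Variable R : realType.

Definition lattice (d : nat) : set 'rV[R]_d :=
  [set x | forall i, x ord0 i \is a Num.int].
Arguments lattice : clear implicits.

Definition convex_body (d : nat) (K : set 'rV[R]_d) : Prop :=
  [/\ compact K, @convex_set R 'rV[R]_d K & K° !=set0].

Definition sym_convex_body (d : nat) (K : set 'rV[R]_d) : Prop :=
  convex_body K /\ forall x, K x -> K (- x).

(* $\mathcal{K}_o^d(k)$: exactly k lattice points in the interior. *)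
Definition sym_convex_body_pts (d k : nat) (K : set 'rV[R]_d) : Prop :=
  sym_convex_body K /\ (K° `&` lattice d #= `I_k)%card.

Definition extremal (n : nat) (B : set 'rV[R]_n) : Prop :=
  sym_convex_body_pts 1 B /\ vol B = (2 ^ n)%:R%:E.

(* The point (y, t) of R^(d-1) x R = R^d: the first d-1 coordinates are those
   of y, the last one is t. *)
Definition row_rcons (d : nat) (y : 'rV[R]_d.-1) (t : R) : 'rV[R]_d :=
  \row_i oapp (y ord0) t (insub (val i)).

Definition lift_set (d : nat) (B : set 'rV[R]_d.-1) (f g : 'rV[R]_d.-1 -> R) :
    set 'rV[R]_d :=
  [set x | exists y t, [/\ x = row_rcons y t, B y & f y <= t <= g y]].

(* Only used for linear phi, which is then automatically bijective. *)
Definition unimodular (d : nat) (phi : 'rV[R]_d -> 'rV[R]_d) : Prop :=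
  phi @` lattice d = lattice d.

Definition cylindrical_lifting (d m : nat) (C : set 'rV[R]_d)
    (B : set 'rV[R]_d.-1) : Prop :=
  exists (phi : {linear 'rV[R]_d -> 'rV[R]_d})
         (a : {linear 'rV[R]_d.-1 -> R^o}),
    unimodular phi /\
    C = phi @` lift_set B (fun y => a y - m%:R) (fun y => a y + m%:R).

End Lifting.

(* Main.v *)
From HB Require Import structures.
Require Import Defs.
From mathcomp Require Import fingroup perm finmap measurable_realfun ring lra zify.

(* Volumes are compared with lattice point counts. A symmetric convex body K
   contains a neighbourhood of the origin, so for s < 1 and a fine mesh h the
   cubes of side h attached to the points of hZ^d in K cover sK, and those
   attached to points of sK stay inside K; hence vol K is the limit of
   h^d #(K /\ hZ^d), which is visibly invariant under unimodular maps.

   Suppose vol C = m 2^d. If x + 2z lies in int C for all z in X, with X a set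
   of lattice vectors, then X - X consists of interior lattice points of C.
   Comparing with the 2m - 1 interior points through an injective additive
   functional gives |X| <= m. When |X| = m, the positive interior points are
   exactly the differences with the least element of X; subtracting the least
   positive one, u, from another one gives again a positive interior point, so
   all interior lattice points are multiples of u, and we may take u = c e_d.
   As the average of |X| over x is m, classes with |X| = m are dense. Looking
   at a generic x near the end of a chord of C in direction e_d, whose class
   lies on that chord, shows that every such chord through int C has length
   exactly 2m. Its midpoint is then both convex and concave, hence linear, in
   the projection of x to R^(d-1), which makes C a cylindrical m-lifting. *)

Set Implicit Arguments.
Unset Strict Implicit.
Unset Printing Implicit Defensive.

Import Order.TTheory GRing.Theory Num.Theory.

Local Open Scope classical_set_scope.
Local Open Scope ring_scope.

(** * Symmetric convex bodies *)

Lemma interiorP (R : realType) (V : normedModType R) (K : set V) (x : V) :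
  K° x <-> exists2 e, 0 < e & forall y, `|y| < e -> K (x + y).
Proof.
split.
  move=> /nbhs_ballP[e /= e0 eK]; exists e => // y ye; apply: eK.
  by rewrite -ball_normE /= opprD addNKr normrN.
move=> [e e0 eK]; apply/nbhs_ballP; exists e => //= y.
rewrite -ball_normE /= distrC => yx.
by rewrite -(subrK x y) addrC; exact: eK.
Qed.

Section SymmetricConvexBodies.
Variables (R : realType) (d : nat).
Implicit Types (K : set 'rV[R]_d) (x y : 'rV[R]_d) (s e : R).

Lemma sym_bodyN K x : sym_convex_body K -> K x -> K (- x).
Proof. by case=> _; exact. Qed.

Lemma body_conv K x y s : sym_convex_body K -> K x -> K y -> 0 <= s <= 1 ->
  K (s *: x + (1 - s) *: y).
Proof.
move=> [[_ cK _] _] Kx Ky s01.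
have := cK x y (Itv01 (proj1 (andP s01)) (proj2 (andP s01))).
by move=> /(_ (mem_set Kx) (mem_set Ky))/set_mem.
Qed.

(** If [K] contains the ball of radius [e] around [x], then a short vector [y] is the midpoint of
    [x + y] and [-(x - y)], both in [K] by symmetry. *)
Lemma sym_body0 K : sym_convex_body K -> exists2 e, 0 < e & forall y, `|y| < e -> K y.
Proof.
move=> sK; have [[_ _ [x /interiorP[e e0 eK]]] _] := sK.
exists e => // y ye.
have -> : y = 2^-1 *: (x + y) + (1 - 2^-1) *: (- (x + - y)).
  rewrite [1 - _](_ : _ = 2^-1); last by field.
  rewrite -scalerDr opprB [x + y]addrC addrACA subrr addr0 -mulr2n.
  by rewrite -(scaler_nat 2 y) scalerA mulVf ?scale1r.
apply: body_conv => //; first exact: eK.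
  by apply: sym_bodyN => //; apply: eK; rewrite normrN.
by apply/andP; split; lra.
Qed.

Lemma body_closed K : sym_convex_body K -> closed K.
Proof. by move=> [[/compact_closed + _ _] _]; apply; exact: norm_hausdorff. Qed.

Lemma body_bounded K : sym_convex_body K ->
  exists2 M, 0 < M & forall x, K x -> `|x| <= M.
Proof.
move=> [[/compact_bounded[M [Mr MK]] _ _] _].
exists (`|M| + 1) => [|x Kx]; first by rewrite ltr_wpDl.
by apply: MK => //; rewrite (le_lt_trans (ler_norm _))// ltrDl.
Qed.

(** The sum is a convex combination of [x] and [y / (1 - s)], the latter in a ball around the
    origin. This is the room in which mesh cubes are placed below. *)
Lemma body_fatten K : sym_convex_body K -> exists2 e, 0 < e &
  forall x y s, 0 <= s < 1 -> K x -> `|y| < (1 - s) * e -> K (s *: x + y).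
Proof.
move=> sK; have [e e0 eK] := sym_body0 sK.
exists e => // x y s /andP[s0 s1] Kx ye.
have s1' : 0 < 1 - s by rewrite subr_gt0.
have -> : y = (1 - s) *: ((1 - s)^-1 *: y).
  by rewrite scalerA mulfV ?scale1r// gt_eqF.
apply: body_conv => //; last by rewrite s0 ltW.
apply: eK; rewrite normrZ gtr0_norm ?invr_gt0//.
by rewrite mulrC ltr_pdivrMr// mulrC.
Qed.

Lemma body_shrink_interior K x s : sym_convex_body K -> K x -> 0 <= s < 1 ->
  K° (s *: x).
Proof.
move=> sK Kx s01; have [e e0 eK] := body_fatten sK; apply/interiorP.
exists ((1 - s) * e) => [|y]; last exact: eK.
by rewrite mulr_gt0// subr_gt0; case/andP: s01.
Qed.

Lemma body_shrink K x s : sym_convex_body K -> K x -> 0 <= s <= 1 -> K (s *: x).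
Proof.
move=> sK Kx s01; rewrite -[_ *: x]addr0 -[X in _ + X](scaler0 _ (1 - s)).
apply: body_conv => //; have [e e0] := sym_body0 sK; apply.
by rewrite normr0.
Qed.

Lemma interior_conv K x y s : sym_convex_body K -> K° x -> K y -> 0 < s <= 1 ->
  K° (s *: x + (1 - s) *: y).
Proof.
move=> sK /interiorP[e e0 eK] Ky /andP[s0 s1]; apply/interiorP.
exists (s * e) => [|z ze]; first exact: mulr_gt0.
have -> : s *: x + (1 - s) *: y + z = s *: (x + s^-1 *: z) + (1 - s) *: y.
  by rewrite scalerDr scalerA mulfV ?gt_eqF// scale1r addrAC.
apply: body_conv => //; last by rewrite ltW.
by apply: eK; rewrite normrZ gtr0_norm ?invr_gt0// mulrC ltr_pdivrMr// mulrC.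
Qed.

Lemma interiorN K x : sym_convex_body K -> K° x -> K° (- x).
Proof.
move=> sK /interiorP[e e0 eK]; apply/interiorP; exists e => // y ye.
have -> : - x + y = - (x - y) by rewrite opprB addrC.
by apply: sym_bodyN => //; apply: eK; rewrite normrN.
Qed.

Lemma interior_convI K x y s : sym_convex_body K -> K° x -> K° y ->
  0 <= s <= 1 -> K° (s *: x + (1 - s) *: y).
Proof.
move=> sK Kx /[dup] Ky /interior_subset Ky' /andP[].
rewrite le_eqVlt => /predU1P[<- _|s0 s1]; last by apply: interior_conv; rewrite ?s0.
by rewrite scale0r add0r subr0 scale1r.
Qed.

Lemma interior0 K : sym_convex_body K -> K° 0.
Proof.
by move=> /sym_body0[e e0 eK]; apply/interiorP; exists e => // y; rewrite add0r; exact: eK.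
Qed.

Lemma body_lim K x : sym_convex_body K ->
  (forall s, 0 <= s < 1 -> K (s *: x)) -> K x.
Proof.
move=> sK sKx; apply: contrapT => nKx.
have : (~` K)° x.
  have : open (~` K) by rewrite openC; exact: body_closed.
  by rewrite openE; exact.
move=> /interiorP[e e0 eK].
have xe : 0 < `|x| + e by rewrite ltr_wpDl.
(* This [t] makes [t *: x] shorter than [e], so [(1 - t) *: x] lies in the ball around [x] that
   avoids [K], against the hypothesis. *)
pose t := e / (`|x| + e).
have t0 : 0 < t by rewrite divr_gt0.
have t1 : t <= 1 by rewrite ler_pdivrMr// mul1r lerDr.
apply: (eK (- (t *: x))).
  rewrite normrN normrZ gtr0_norm// /t mulrAC ltr_pdivrMr//.
  by rewrite ltr_pM2l// ltrDl.
rewrite -{1}[x]scale1r -scalerBl; apply: sKx.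
by apply/andP; split; lra.
Qed.

End SymmetricConvexBodies.

(** * Preimages of bodies under invertible matrices *)

Section LinearPreimages.
Variables (R : realType) (d : nat).
Implicit Types (K : set 'rV[R]_d) (x y : 'rV[R]_d) (s e : R) (M : 'M[R]_d).

Lemma norm_rVE x : `|x| = \big[Num.max/0]_(ij : 'I_1 * 'I_d) `|x ij.1 ij.2|.
Proof. by rewrite /Num.Def.normr /= mx_normrE. Qed.

Lemma le_norm_rVP x e : 0 <= e -> reflect (forall i, `|x 0 i| <= e) (`|x| <= e).
Proof.
move=> e0; rewrite norm_rVE; apply: (iffP (bigmax_leP _ _ _ _)).
  by move=> [_ xe] i; exact: (xe (0, i)).
by move=> xe; split=> // -[i j] _ /=; rewrite (ord1 i).
Qed.

Lemma coord_le_norm x i : `|x 0 i| <= `|x|.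
Proof. by have /le_norm_rVP := lexx `|x|; apply. Qed.

Lemma lt_norm_rVP x e : 0 < e -> reflect (forall i, `|x 0 i| < e) (`|x| < e).
Proof.
move=> e0; apply: (iffP idP) => [xe i|xe].
  exact: le_lt_trans (coord_le_norm x i) xe.
rewrite norm_rVE; apply/bigmax_ltP; split=> // -[i j] _ /=.
by rewrite (ord1 i).
Qed.

Lemma mulmx_bounded M : exists2 c, 0 < c & forall x, `|x *m M| <= c * `|x|.
Proof.
(* The summand 1 keeps the constant positive even for [M = 0]. *)
exists (1 + \sum_i \sum_j `|M i j|).
  by rewrite ltr_wpDr// sumr_ge0// => i _; exact: sumr_ge0.
move=> x; apply/le_norm_rVP => [|j].
  by rewrite mulr_ge0// addr_ge0// sumr_ge0// => i _; exact: sumr_ge0.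
rewrite mxE (le_trans (ler_norm_sum _ _ _))//.
apply: (@le_trans _ _ ((\sum_i \sum_j `|M i j|) * `|x|)); last first.
  by rewrite ler_wpM2r// lerDr.
rewrite mulr_suml; apply: ler_sum => i _; rewrite normrM mulrC.
apply: ler_pM => //; last exact: coord_le_norm.
by rewrite (bigD1 j)//= lerDl sumr_ge0.
Qed.

Lemma mulmx_continuous M : continuous (fun x => x *m M).
Proof.
have [c c0 cM] := mulmx_bounded M.
move=> x; apply/(@cvgrPdist_lt _ _ _ _ (nbhs_filter x)) => e e0; apply/nbhs_ballP.
exists (e / c) => /=; first exact: divr_gt0.
move=> y; rewrite -ball_normE /= => yx; rewrite -mulmxBl.
by rewrite (le_lt_trans (cM _))// mulrC -ltr_pdivlMr.
Qed.

Lemma interior_mulmx M K : M \in unitmx ->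
  [set x | K (x *m M)]° = [set x | K° (x *m M)].
Proof.
move=> uM; rewrite predeqE => x; split => /interiorP[e e0 eK]; apply/interiorP.
  have [c c0 cM] := mulmx_bounded (invmx M).
  exists (e / c) => [|y ye]; first exact: divr_gt0.
  rewrite -(mulmxKV uM y) -mulmxDl; apply: eK.
  by rewrite (le_lt_trans (cM _))// mulrC -ltr_pdivlMr.
have [c c0 cM] := mulmx_bounded M.
exists (e / c) => [|y ye]; first exact: divr_gt0.
rewrite /= mulmxDl; apply: eK.
by rewrite (le_lt_trans (cM _))// mulrC -ltr_pdivlMr.
Qed.

Lemma body_mulmx M K : M \in unitmx -> sym_convex_body K ->
  sym_convex_body [set x | K (x *m M)].
Proof.
move=> uM sK; split; last by move=> x /= Kx; rewrite mulNmx; exact: sym_bodyN.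
split.
- apply: bounded_closed_compact.
    have [B B0 BK] := body_bounded sK.
    have [c c0 cM] := mulmx_bounded (invmx M).
    exists (c * B); split => [|N]; first exact: num_real.
    move=> cBN x /= Kx.
    rewrite -(mulmxK uM x) (le_trans (cM _))// (le_trans _ (ltW cBN))//.
    by rewrite ler_pM2l//; exact: BK.
  have := body_closed sK; apply: (@preimage_closed _ _ (fun x => x *m M)) => //.
  by move=> x _; exact: mulmx_continuous.
- move=> x y l /set_mem Kx /set_mem Ky; apply/mem_set.
  change (K ((l%:num *: (x : 'rV[R]_d) + (1 - l%:num) *: (y : 'rV[R]_d)) *m M)).
  by rewrite mulmxDl -!scalemxAl; apply: body_conv => //; apply/andP; split.
- by exists 0; rewrite interior_mulmx//= mul0mx; exact: interior0.
Qed.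

Lemma body_scale s K : 0 < s -> sym_convex_body K ->
  sym_convex_body [set x | K (s *: x)].
Proof.
move=> s0 sK; rewrite [X in sym_convex_body X](_ : _ = [set x | K (x *m s%:M)]).
  by apply: body_mulmx => //; rewrite unitmxE det_scalar unitfE expf_neq0// gt_eqF.
by rewrite predeqE => x /=; rewrite mul_mx_scalar.
Qed.

End LinearPreimages.

(** * Lattice point counts and volume *)

(** Let [s] tend to 1 from the left. The volume comparisons below are first proved up to a power of
    a dilation factor [s < 1], which this removes. *)
Lemma pow_lim (R : realType) k (a c v : R) : a < 1 ->
  (forall s, a < s < 1 -> s ^+ k * c <= v) -> c <= v.
Proof.
move=> a1 cv.
have cvgc : (fun s : R => s ^+ k * c) x @[x --> 1^'-] --> c.
  have ck : (fun s : R => s ^+ k * c) x @[x --> (1 : R)] --> 1 ^+ k * c.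
    by apply: cvgMr_tmp; exact: exprn_continuous.
  by apply: cvg_at_left_filter; rewrite expr1n mul1r in ck.
rewrite -(cvg_lim _ cvgc)//; apply: limr_le; first by apply/cvg_ex; exists c.
near=> s; apply: cv; apply/andP; split; first by near: s; exact: nbhs_left_gt.
by near: s; exact: nbhs_left_lt.
Unshelve. all: by end_near. Qed.

Section LatticeCount.
Variables (R : realType) (d : nat).
Implicit Types (K : set 'rV[R]_d) (s h : R) (z : 'rV[int]_d).

Definition latvec z : 'rV[R]_d := map_mx intr z.

Definition latpts h K : set 'rV[int]_d := [set z | K (h *: latvec z)].

(** Since [fset_set] sends infinite sets to the empty one, this is the true count only when
    [latpts h K] is finite, as for bounded [K] and [h > 0]. *)
Definition nlat h K : nat := (#|` fset_set (latpts h K)|)%fset.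

Lemma latvecE z i : latvec z 0 i = (z 0 i)%:~R.
Proof. by rewrite mxE. Qed.

Lemma finite_int_box (N : nat) :
  finite_set [set z : 'rV[int]_d | forall i, `|z 0 i| <= N%:Z].
Proof.
pose f (r : 'rV['I_(N.*2.+1)]_d) : 'rV[int]_d :=
  map_mx (fun j : 'I_(N.*2.+1) => (j : nat)%:Z - N%:Z) r.
apply: (@sub_finite_set _ _ (f @` setT)); last by apply: finite_image; exact: finite_finset.
move=> z /= zN; exists (\row_i inord (absz (z 0 i + N%:Z))) => //.
apply/rowP => i; rewrite !mxE; have := zN i.
move: (z 0 i) => k kN; rewrite inordK; lia.
Qed.

Lemma latpts_finite h K (M : R) : 0 < h -> (forall x, K x -> `|x| <= M) ->
  finite_set (latpts h K).
Proof.
move=> h0 KM; pose N := Num.truncn (M / h).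
apply: (@sub_finite_set _ _ _ _ (finite_int_box N.+1)) => z /= /KM zM i.
have := le_trans (coord_le_norm _ i) zM.
rewrite mxE latvecE normrM gtr0_norm// mulrC -ler_pdivlMr// => zMh.
have := le_lt_trans zMh (truncnS_gt (M / h)).
rewrite -/N -intr_norm pmulrn ltr_int; lia.
Qed.

Lemma nlat_inj (f : 'rV[int]_d -> 'rV[int]_d) h h' K K' (M M' : R) :
  0 < h -> 0 < h' ->
  (forall x, K x -> `|x| <= M) -> (forall x, K' x -> `|x| <= M') ->
  injective f -> (forall z, latpts h K z -> latpts h' K' (f z)) ->
  (nlat h K <= nlat h' K')%N.
Proof.
move=> h0 h'0 KM K'M fI fK.
have finK := latpts_finite h0 KM.
have finK' := latpts_finite h'0 K'M.
rewrite /nlat -(size_map f); apply: uniq_leq_size.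
  by rewrite map_inj_uniq// fset_uniq.
move=> _ /mapP[z + ->]; rewrite !in_fset_set// => /set_mem zK; apply/mem_set.
exact: fK.
Qed.

End LatticeCount.

Lemma inv_small (R : realType) (e : R) : 0 < e -> exists n, n.+1%:R^-1 < e.
Proof.
move=> e0; exists (Num.truncn e^-1); have := truncnS_gt e^-1.
by rewrite -[X in _ -> _ < X]invrK ltf_pV2 ?posrE ?invr_gt0.
Qed.

(** * Mesh cubes and measurability of closed sets *)

Section VolumeByCounting.
Variables (R : realType) (d : nat).
Implicit Types (K : set 'rV[R]_d) (s h : R) (z : 'rV[int]_d).

Definition tset K : set (d.-tuple (measurableTypeR R)) := [set t | K (\row_i tnth t i)].

(** The side [l] is independent of the mesh [h]: cubes with [l = h] cover the space, while cubes
    with [l < h] are pairwise disjoint. *)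
Definition cube h l z : set (d.-tuple (measurableTypeR R)) :=
  [set t | forall i, tnth t i \in `[h * (z 0 i)%:~R, h * (z 0 i)%:~R + l]].

Lemma cube_measurable h l z : measurable (cube h l z).
Proof.
rewrite (_ : cube h l z = \bigcap_(i in [set: 'I_d])
    (fun t => tnth t i) @^-1` `[h * (z 0 i)%:~R, h * (z 0 i)%:~R + l]%classic).
  apply: fin_bigcap_measurable => [|i _]; first exact: finite_finset.
  by rewrite -[X in measurable X]setTI; exact: measurable_tnth.
by rewrite predeqE => t; split => [tB i _|tB i]; [exact: tB|exact: (tB i I)].
Qed.

Lemma cube_vol h l z : 0 <= l -> lebesgue_tuple (cube h l z) = (l ^+ d)%:E.
Proof.
move=> l0; rewrite lebesgue_tuple_box => [|i]; last by rewrite lerDl.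
congr EFin; rewrite -[in RHS](card_ord d) -prodr_const.
by apply: eq_bigr => i _; rewrite addrC addKr.
Qed.

Lemma cube_near h l z (x : 'rV[R]_d) : 0 <= l ->
  (forall i, x 0 i \in `[h * (z 0 i)%:~R, h * (z 0 i)%:~R + l]) ->
  `|h *: latvec R z - x| <= l.
Proof.
move=> l0 xz; apply/le_norm_rVP => // i; rewrite !mxE.
by have := xz i; rewrite in_itv /= ler_norml => /andP[? ?]; apply/andP; split; lra.
Qed.

Lemma floor_near h (x : 'rV[R]_d) : 0 < h -> exists z : 'rV[int]_d, forall i,
  x 0 i \in `[h * (z 0 i)%:~R, h * (z 0 i)%:~R + h].
Proof.
move=> h0; exists (\row_i Num.floor (x 0 i / h)) => i; rewrite mxE in_itv /=.
have /andP[] := floor_itv (x 0 i / h); rewrite ler_pdivlMr// mulrC => -> /=.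
rewrite ltr_pdivrMr// intrD mulrDl mul1r => /ltW; by rewrite mulrC.
Qed.

(** The measurable sets of tuples come from coordinates. A closed [K] is the intersection over [n]
    of the union of those closed mesh cubes of side [1/(n+1)] that meet [K], and each such union is
    countable. *)
Lemma closed_measurable K : closed K -> measurable (tset K).
Proof.
move=> cK.
pose G n z := exists2 x, K x & forall i,
  x 0 i \in `[n.+1%:R^-1 * (z 0 i)%:~R, n.+1%:R^-1 * (z 0 i)%:~R + n.+1%:R^-1].
pose F n z := if `[< G n z >] then cube n.+1%:R^-1 n.+1%:R^-1 z else set0.
rewrite [X in measurable X](_ : _ = \bigcap_n \bigcup_z F n z); last first.
  rewrite predeqE => t; split => [Kt n _|Ft].
    have n0 : 0 < n.+1%:R^-1 :> R by rewrite invr_gt0.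
    have [z tz] := floor_near (\row_i tnth t i) n0.
    exists z => //; rewrite /F ifT.
      by move=> i; have := tz i; rewrite mxE.
    by apply/asboolP; exists (\row_i tnth t i).
  apply: contrapT => nKt.
  have : (~` K)° (\row_i tnth t i).
    have : open (~` K) by rewrite openC.
    by rewrite openE; exact.
  move=> /interiorP[e e0 eK].
  (* Half of [e], because two points of a common cube are compared through its corner, at the cost
     of one side length each. *)
  have [n ne] : exists n, n.+1%:R^-1 < e / 2 by apply: inv_small; lra.
  have n0 : 0 <= n.+1%:R^-1 :> R by rewrite invr_ge0.
  have [z _] := Ft n I; rewrite /F; case: asboolP => // -[x Kx xz] tz.
  apply: (eK (x - \row_i tnth t i)); last by rewrite addrC subrK.
  rewrite -(subrK (n.+1%:R^-1 *: latvec R z) x) -addrA (le_lt_trans (ler_normD _ _))//.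
  have h1 := cube_near n0 xz.
  have h2 : `|n.+1%:R^-1 *: latvec R z - \row_i tnth t i| <= n.+1%:R^-1.
    by apply: cube_near => // i; rewrite mxE; exact: tz.
  rewrite [X in X + _]distrC (le_lt_trans (lerD h1 h2))//.
  by move: ne; move: (n.+1%:R^-1) => a; lra.
apply: bigcapT_measurable => n; apply: countable_bigcupT_measurable; first exact: countableP.
by move=> z; rewrite /F; case: ifP => _ //; exact: cube_measurable.
Qed.

End VolumeByCounting.

(** * Two-sided comparison of volumes with lattice counts *)

Section VolumeDilation.
Variables (R : realType) (d : nat).
Implicit Types (K : set 'rV[R]_d) (s t h : R) (z : 'rV[int]_d).

Definition dil s K := [set x : 'rV[R]_d | K (s^-1 *: x)].

Lemma dil_dil s t K : dil s (dil t K) = dil (s * t) K.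
Proof. by rewrite predeqE => x; rewrite /dil /= scalerA invfM mulrC. Qed.

Lemma dil1 K : dil 1 K = K.
Proof. by rewrite predeqE => x; rewrite /dil /= invr1 scale1r. Qed.

Lemma body_dil s K : 0 < s -> sym_convex_body K -> sym_convex_body (dil s K).
Proof. by move=> s0; apply: body_scale; rewrite invr_gt0. Qed.

Lemma nlat_dil s h K : nlat h (dil s K) = nlat (h / s) K.
Proof.
congr (#|` fset_set _|)%fset; rewrite predeqE => z.
by rewrite /latpts /dil /= scalerA mulrC.
Qed.

Lemma body_measurable K : sym_convex_body K -> measurable (tset K).
Proof. by move=> sK; apply: closed_measurable; exact: body_closed. Qed.

Lemma body_latpts_finite h K : 0 < h -> sym_convex_body K -> finite_set (latpts h K).
Proof. by move=> h0 /body_bounded[M _ KM]; exact: latpts_finite h0 KM. Qed.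

(** A point of [s K] lies in a mesh cube whose corner is at distance at most [h < (1 - s) e], hence
    in [K] by [body_fatten]. So the cubes of side [h] at the mesh points of [K] cover [s K]. *)
Lemma vol_dil_le_nlat K : sym_convex_body K -> exists2 e, 0 < e &
  forall s h, 0 < s < 1 -> 0 < h < (1 - s) * e ->
  (vol (dil s K) <= (h ^+ d * (nlat h K)%:R)%:E)%E.
Proof.
move=> sK; have [e e0 eK] := body_fatten sK.
exists e => // s h /andP[s0 s1] /andP[h0 hse].
have [mu muE] := lebesgue_tuple_measure R d.
rewrite /vol muE; have fK := body_latpts_finite h0 sK.
apply: (@le_trans _ _ (\sum_(z \in latpts h K) mu (cube h h z))%E).
  apply: content_sub_fsum => //.
  - by move=> z _; exact: cube_measurable.
  - by apply: body_measurable; exact: body_dil.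
  move=> t; set x := \row_i tnth t i; rewrite /= /dil /= => Kx.
  have [z xz] := floor_near x h0.
  exists z => /=; last by move=> i; have := xz i; rewrite mxE.
  rewrite /latpts /= (_ : h *: latvec R z = s *: (s^-1 *: x) + (h *: latvec R z - x)).
    apply: eK => //; first by rewrite ltW.
    exact: le_lt_trans (cube_near (ltW h0) xz) hse.
  by rewrite scalerA mulfV ?gt_eqF// scale1r addrC subrK.
rewrite fsbig_finite//= (eq_bigr (fun=> (h ^+ d)%:E)) => [|z _]; last first.
  by rewrite -muE cube_vol// ltW.
by rewrite sumEFin big_const_seq count_predT iter_addr_0 mulr_natr.
Qed.

(** Closed cubes of side [h] would share faces, so the side is reduced to [s h]: the cubes become
    disjoint, at the price of the factor [s ^+ d], and by [body_fatten] those attached to mesh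
    points of [s K] stay in [K]. *)
Lemma nlat_dil_le_vol K : sym_convex_body K -> exists2 e, 0 < e &
  forall s h, 0 < s < 1 -> 0 < h < (1 - s) * e ->
  ((s ^+ d * (h ^+ d * (nlat h (dil s K))%:R))%:E <= vol K)%E.
Proof.
move=> sK; have [e e0 eK] := body_fatten sK.
exists e => // s h /andP[s0 s1] /andP[h0 hse].
have [mu muE] := lebesgue_tuple_measure R d.
rewrite /vol muE; have fK := body_latpts_finite h0 (body_dil s0 sK).
have sh0 : 0 <= s * h by rewrite mulr_ge0 ?ltW.
have shh : s * h < h by rewrite gtr_pMl.
have <- : mu (\bigcup_(z in latpts h (dil s K)) cube h (s * h) z) =
    (s ^+ d * (h ^+ d * (nlat h (dil s K))%:R))%:E.
  rewrite measure_fin_bigcup//; last by move=> z _; exact: cube_measurable.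
    rewrite fsbig_finite//= (eq_bigr (fun=> ((s * h) ^+ d)%:E)) => [|z _]; last first.
      by rewrite -muE cube_vol.
    by rewrite sumEFin big_const_seq count_predT iter_addr_0 mulrA -exprMn mulr_natr.
  move=> z z' _ _ [t [/= tz tz']]; apply/rowP => i.
  have := tz i; have := tz' i; rewrite !in_itv /= => /andP[a b] /andP[a' b'].
  have : h * `|(z 0 i)%:~R - (z' 0 i)%:~R| < h * 1.
    rewrite -[X in X * `|_|](gtr0_norm h0) -normrM mulrBr mulr1 ltr_norml.
    by apply/andP; split; lra.
  rewrite ltr_pM2l// -intrB -intr_norm -[1]/(1%:~R) ltr_int.
  by move: (z 0 i) (z' 0 i); clear => p q pq; lia.
apply: le_measure.
- by apply/mem_set/fin_bigcup_measurable => // z _; exact: cube_measurable.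
- by apply/mem_set; exact: (body_measurable sK).
move=> t [z /= Kz tz]; set x := \row_i tnth t i.
have -> : x = s *: (s^-1 *: (h *: latvec R z)) + (x - h *: latvec R z).
  by rewrite scalerA mulfV ?gt_eqF// scale1r addrC subrK.
apply: eK => //; first by rewrite ltW.
rewrite distrC (le_lt_trans (@cube_near _ _ h (s * h) z x sh0 _))//.
  by move=> i; rewrite mxE; exact: tz.
exact: lt_trans shh hse.
Qed.

End VolumeDilation.

(** * Finiteness and homogeneity of the volume *)

Section RealVolume.
Variables (R : realType) (d : nat).
Implicit Types (K : set 'rV[R]_d) (s t h e : R) (z : 'rV[int]_d).

Lemma small_mesh (a b : R) : 0 < a -> 0 < b -> exists h, 0 < h < a /\ h < b.
Proof.
move=> a0 b0; exists (Num.min a b / 2).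
have m0 : 0 < Num.min a b by rewrite lt_min a0 b0.
have ma : Num.min a b <= a by rewrite ge_min lexx.
have mb : Num.min a b <= b by rewrite ge_min lexx orbT.
by split; [apply/andP; split|]; lra.
Qed.

(** Writing [K] as the dilate by [1/2] of [2 K] bounds its volume by a finite lattice count. *)
Lemma vol_fin_num K : sym_convex_body K -> vol K \is a fin_num.
Proof.
move=> sK; rewrite ge0_fin_numE; last first.
  by rewrite /vol; have [mu ->] := lebesgue_tuple_measure R d.
have h0 : 0 < 2^-1 :> R by lra.
have sK' : sym_convex_body (dil 2 K) by apply: body_dil => //; lra.
have [e e0 eK] := vol_dil_le_nlat sK'.
have [h [/andP[h0' he] _]] : exists h, 0 < h < (1 - 2^-1) * e /\ h < 1.
  by apply: small_mesh => //; rewrite mulr_gt0//; lra.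
have := eK 2^-1 h; rewrite dil_dil mulVf// dil1 => /(_ _ _)/le_lt_trans; apply.
- by apply/andP; split; lra.
- by rewrite h0' he.
- exact: ltry.
Qed.

Definition rvol K : R := fine (vol K).

Lemma rvolE K : sym_convex_body K -> vol K = (rvol K)%:E.
Proof. by move=> sK; rewrite /rvol fineK// vol_fin_num. Qed.

Lemma rvol_dil_le_nlat K : sym_convex_body K -> exists2 e, 0 < e &
  forall s h, 0 < s < 1 -> 0 < h < (1 - s) * e ->
  rvol (dil s K) <= h ^+ d * (nlat h K)%:R.
Proof.
move=> sK; have [e e0 eK] := vol_dil_le_nlat sK; exists e => // s h s01 he.
rewrite -lee_fin -rvolE; first exact: eK.
by apply: body_dil => //; case/andP: s01.
Qed.

Lemma nlat_dil_le_rvol K : sym_convex_body K -> exists2 e, 0 < e &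
  forall s h, 0 < s < 1 -> 0 < h < (1 - s) * e ->
  s ^+ d * (h ^+ d * (nlat h (dil s K))%:R) <= rvol K.
Proof.
move=> sK; have [e e0 eK] := nlat_dil_le_vol sK; exists e => // s h s01 he.
by rewrite -lee_fin -rvolE//; exact: eK.
Qed.

Lemma dil_mono s t K : sym_convex_body K -> 0 < s -> s <= t -> dil s K `<=` dil t K.
Proof.
move=> sK s0 st x; rewrite /dil /= => Kx.
have t0 : 0 < t by exact: lt_le_trans st.
have -> : t^-1 *: x = (s / t) *: (s^-1 *: x).
  by rewrite scalerA mulrAC mulfV ?mul1r// gt_eqF.
apply: body_shrink => //; apply/andP; split.
  by rewrite divr_ge0// ltW.
by rewrite ler_pdivrMr// mul1r.
Qed.

Lemma rvol_mono K K' : sym_convex_body K -> sym_convex_body K' -> K `<=` K' ->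
  rvol K <= rvol K'.
Proof.
move=> sK sK' KK'; rewrite -lee_fin -!rvolE// /vol.
have [mu ->] := lebesgue_tuple_measure R d.
apply: le_measure; try (apply/mem_set; exact: body_measurable).
by move=> t; exact: KK'.
Qed.

(** As [K] is closed, it is the intersection of the decreasing dilates by [1 + 1/(n+1)]; continuity
    of the measure from above concludes. *)
Lemma rvol_dil_right_cont K e : sym_convex_body K -> 0 < e ->
  exists a, 0 < a < 1 /\ forall s, a <= s < 1 -> rvol (dil s^-1 K) <= rvol K + e.
Proof.
move=> sK e0.
pose l n : R := 1 + n.+1%:R^-1.
have l1 n : 1 < l n by rewrite ltrDl invr_gt0.
have l0 n : 0 < l n by exact: lt_trans (l1 n).
have sD n : sym_convex_body (dil (l n) K) by exact: body_dil.
suff [n nK] : exists n, rvol (dil (l n) K) <= rvol K + e.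
  exists (l n)^-1; split; first by rewrite invr_gt0 l0/= invf_lt1.
  move=> s /andP[ls s1]; apply: le_trans nK.
  have s0 : 0 < s by rewrite (lt_le_trans _ ls)// invr_gt0.
  apply: rvol_mono => //; first by apply: body_dil => //; rewrite invr_gt0.
  by apply: dil_mono; rewrite ?invr_gt0// -[l n]invrK lef_pV2// posrE invr_gt0.
apply: contrapT => /forallNP nK.
have capE : \bigcap_n tset (dil (l n) K) = tset K.
  rewrite predeqE => t; split => [Kt|Kt n _]; last first.
    by apply: (@dil_mono 1); rewrite ?ltW// dil1.
  apply: body_lim => // s /andP[s0 s1].
  have [n ns] : exists n, n.+1%:R^-1 < 1 - s by apply: inv_small; rewrite subr_gt0.
  have -> : s *: (\row_i tnth t i) = (s * l n) *: ((l n)^-1 *: (\row_i tnth t i)).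
    by rewrite scalerA -mulrA mulfV ?mulr1// gt_eqF.
  apply: body_shrink => //; first exact: (Kt n I).
  rewrite mulr_ge0//=; last by rewrite ltW.
  have n0 : 0 < n.+1%:R^-1 :> R by rewrite invr_gt0.
  rewrite /l; move: ns n0; move: (n.+1%:R^-1) => a ns a0; nra.
have [mu muE] := lebesgue_tuple_measure R d.
have vE K' : vol K' = mu (tset K') by rewrite /vol muE.
have cv : (mu \o (fun n => tset (dil (l n) K))) x @[x --> \oo] --> mu (tset K).
  rewrite -capE; apply: nonincreasing_cvg_mu.
  - by rewrite -vE rvolE// ltry.
  - by move=> n; exact: body_measurable.
  - by rewrite capE; exact: body_measurable.
  move=> n m nm; apply/subsetPset => t; apply: dil_mono => //.
  by rewrite lerD2l lef_pV2 ?posrE// ler_nat.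
have : ((rvol K + e)%:E <= mu (tset K))%E.
  rewrite -(cvg_lim _ cv)//; apply: lime_ge; first by apply/cvg_ex; eexists; exact: cv.
  apply: nearW => n; rewrite /= -vE rvolE// lee_fin.
  by have /negP := nK n; rewrite -ltNge => /ltW.
by rewrite -vE rvolE// lee_fin gerDl leNgt e0.
Qed.

(** Counting [(s/t) K] at mesh [h] is the same as counting [K/t] at mesh [h/s]. The first count
    bounds the volume of [s K] from above, the second is bounded by the volume of [K/t^2], and right
    continuity of the volume handles [t] near 1. *)
Lemma rvol_dil_le s K : 0 < s -> sym_convex_body K -> rvol (dil s K) <= s ^+ d * rvol K.
Proof.
move=> s0 sK; apply/ler_addgt0Pr => e e0.
have [a [/andP[a0 a1] aK]] : exists a, 0 < a < 1 /\ forall t, a <= t < 1 ->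
    rvol (dil t^-1 K) <= rvol K + e / s ^+ d.
  by apply: rvol_dil_right_cont => //; rewrite divr_gt0// exprn_gt0.
(* The square root ensures [a <= t * t], as right continuity is applied to the factor [t * t]. *)
have sr1 : Num.sqrt a < 1 by rewrite -sqrtr1 ltr_sqrt.
have sr0 : 0 <= Num.sqrt a := sqrtr_ge0 a.
apply: (@pow_lim _ d (Num.sqrt a)) => // t /andP[ta t1].
have t0 : 0 < t by exact: le_lt_trans ta.
have t01 : 0 < t < 1 by rewrite t0.
have at2 : a <= t * t < 1.
  have : a = Num.sqrt a * Num.sqrt a by rewrite -expr2 sqr_sqrtr// ltW.
  by move=> aE; apply/andP; split; nra.
have sK1 : sym_convex_body (dil (s / t) K) by apply: body_dil => //; rewrite divr_gt0.
have sK2 : sym_convex_body (dil (t * t)^-1 K) by apply: body_dil => //; rewrite invr_gt0 mulr_gt0.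
have [e1 e10 up] := rvol_dil_le_nlat sK1.
have [e2 e20 lo] := nlat_dil_le_rvol sK2.
have u0 : 0 < 1 - t by rewrite subr_gt0.
have [h [/andP[h0 h1] h2]] : exists h, 0 < h < (1 - t) * e1 /\ h < s * ((1 - t) * e2).
  by apply: small_mesh; rewrite ?mulr_gt0.
have := up t h t01; rewrite h0 h1 => /(_ isT).
have := lo t (h / s) t01; rewrite divr_gt0// ltr_pdivrMr// mulrC h2 => /(_ isT).
rewrite !dil_dil (_ : t * (t * t)^-1 = t^-1); last first.
  by rewrite invfM mulrA mulfV ?mul1r// gt_eqF.
rewrite (_ : t * (s / t) = s); last by rewrite mulrCA mulfV ?mulr1// gt_eqF.
rewrite !nlat_dil invrK (_ : h / (s / t) = h / s * t); last by rewrite invfM invrK mulrA.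
move: (nlat _ _)%:R => N; rewrite expr_div_n => lo' up'.
apply: (@le_trans _ _ (t ^+ d * (h ^+ d * N))).
  by rewrite ler_pM2l// exprn_gt0.
have -> : t ^+ d * (h ^+ d * N) = s ^+ d * (t ^+ d * (h ^+ d / s ^+ d * N)).
  by field; rewrite expf_neq0// gt_eqF.
rewrite (_ : _ + e = s ^+ d * (rvol K + e / s ^+ d)); last first.
  by field; rewrite expf_neq0// gt_eqF.
by rewrite ler_pM2l ?exprn_gt0// (le_trans lo')// aK.
Qed.

Lemma rvol_dil s K : 0 < s -> sym_convex_body K -> rvol (dil s K) = s ^+ d * rvol K.
Proof.
move=> s0 sK; apply/eqP; rewrite eq_le rvol_dil_le//=.
have := @rvol_dil_le s^-1 (dil s K); rewrite invr_gt0 => /(_ s0 (body_dil s0 sK)).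
by rewrite dil_dil mulVf ?gt_eqF// dil1 exprVn mulrC ler_pdivlMr ?exprn_gt0// mulrC.
Qed.

End RealVolume.

(** * Unimodular invariance and density of full classes *)

Section UnimodularInvariance.
Variables (R : realType) (d : nat).
Implicit Types (K : set 'rV[R]_d) (s h : R) (z : 'rV[int]_d) (A : 'M[int]_d).

Definition realmx A : 'M[R]_d := map_mx intr A.

Lemma latvecM z A : latvec R (z *m A) = latvec R z *m realmx A.
Proof. by rewrite /latvec map_mxM. Qed.

Lemma latvec_inj : injective (@latvec R d).
Proof.
move=> z z' /rowP zz'; apply/rowP => i; have := zz' i; rewrite !mxE; exact: intr_inj.
Qed.

Lemma realmx_unit A : A \in unitmx -> realmx A \in unitmx.
Proof. by rewrite !unitmxE det_map_mx; exact: rmorph_unit. Qed.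

Lemma dil_mulmx s K (M : 'M[R]_d) :
  dil s [set x | K (x *m M)] = [set x | dil s K (x *m M)].
Proof. by rewrite predeqE => x; rewrite /dil /= scalemxAl. Qed.

(** Multiplication by the integer matrix [A] maps the mesh points of the preimage injectively to
    mesh points of [K]. *)
Lemma rvol_mulmx_le K A : A \in unitmx -> sym_convex_body K ->
  rvol [set x | K (x *m realmx A)] <= rvol K.
Proof.
move=> uA sK; have uM := realmx_unit uA.
set K' := [set x | _]; have sK' : sym_convex_body K' by exact: body_mulmx.
(* One factor [s ^+ d] comes from the lower count, and two from the volume of the body dilated twice
   by [s]. *)
apply: (@pow_lim _ (d + (d + d)) 0) => [|s /andP[s0 s1]]; first exact: ltr01.
have sD : sym_convex_body (dil s K') by exact: body_dil.
have sD' : sym_convex_body (dil s K) by exact: body_dil.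
have [e1 e10 up] := rvol_dil_le_nlat sD.
have [e2 e20 lo] := nlat_dil_le_rvol sK.
have u0 : 0 < 1 - s by rewrite subr_gt0.
have [h [/andP[h0 h1] h2]] : exists h, 0 < h < (1 - s) * e1 /\ h < (1 - s) * e2.
  by apply: small_mesh; rewrite ?mulr_gt0.
have s01 : 0 < s < 1 by rewrite s0.
have := up s h s01; rewrite h0 h1 => /(_ isT); rewrite !rvol_dil// => up'.
have := lo s h s01; rewrite h0 h2 => /(_ isT); apply: le_trans.
rewrite exprD -mulrA ler_pM2l ?exprn_gt0// exprD -mulrA (le_trans up')//.
rewrite ler_pM2l ?exprn_gt0// ler_nat.
have [M _ KM] := body_bounded sD; have [M' _ KM'] := body_bounded sD'.
have AI := can_inj (mulmxK uA) : injective (fun z => z *m A).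
apply: (nlat_inj h0 h0 KM KM' AI).
move=> z; rewrite /latpts /= dil_mulmx /=.
by rewrite -scalemxAl -latvecM.
Qed.

Lemma rvol_mulmx K A : A \in unitmx -> sym_convex_body K ->
  rvol [set x | K (x *m realmx A)] = rvol K.
Proof.
move=> uA sK; apply/eqP; rewrite eq_le rvol_mulmx_le//=.
have sK' : sym_convex_body [set x | K (x *m realmx A)].
  by apply: body_mulmx => //; exact: realmx_unit.
have uA' : invmx A \in unitmx by rewrite unitmx_inv.
apply: le_trans (rvol_mulmx_le uA' sK').
rewrite [leRHS](_ : _ = rvol K)//; congr rvol; rewrite predeqE => x /=.
by rewrite -mulmxA -map_mxM mulVmx// map_mx1 mulmx1.
Qed.

End UnimodularInvariance.

(** * Density of the points with full classes modulo twice the lattice *)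

Section Density.
Variables (R : realType) (d m : nat) (C : set 'rV[R]_d).
Hypothesis sC : sym_convex_body C.
Hypothesis C_le : forall x (X : seq 'rV[int]_d), uniq X ->
  (forall z, z \in X -> C° (x + 2 *: latvec R z)) -> (size X <= m)%N.

Lemma card_small_ord (M P : nat) : (M <= P)%N -> #|[pred i : 'I_P | (i < M)%N]| = M.
Proof.
move=> MP; rewrite -sum1_card (eq_bigl (fun i : 'I_P => (i < M)%N))//.
by rewrite (big_ord_narrow MP) sum1_card card_ord.
Qed.

(* Each residue class modulo 2N contributes at most m points, and strictly
   fewer if its representative lies in the cube k0 + [0, M)^d. *)
Lemma nlat_class_bound (N M : nat) (k0 : 'rV[int]_d) (K : set 'rV[R]_d) :
  (0 < N)%N -> (M <= N.*2)%N ->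
  finite_set (latpts N%:R^-1 K) -> K `<=` C° ->
  (forall (j : 'I_d -> nat) (X : seq 'rV[int]_d), (forall i, (j i < M)%N) -> uniq X ->
    (forall z, z \in X ->
       C° (N%:R^-1 *: latvec R (k0 + \row_i (j i)%:Z) + 2 *: latvec R z)) ->
    (size X < m)%N) ->
  (nlat N%:R^-1 K + M ^ d <= m * N.*2 ^ d)%N.
Proof.
move=> N0 MN fZ KC small; set P := N.*2.
have P0 : (0 < P)%N by rewrite double_gt0.
have modP (k : int) : (`|(k %% P%:Z)%Z| < P)%N.
  by have := ltz_pmod k (_ : 0 < P%:Z) => /(_ P0); have := modz_ge0 k (_ : P%:Z != 0); lia.
pose rho (z : 'rV[int]_d) : {ffun 'I_d -> 'I_P} := [ffun i => Ordinal (modP (z 0 i - k0 0 i))].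
set Z := fset_set (latpts N%:R^-1 K); rewrite /nlat -/Z.
pose good (r : {ffun 'I_d -> 'I_P}) := [forall i, (r i < M)%N].
have goodE : (M ^ d = \sum_(r | good r) 1)%N.
  rewrite sum1_card -[in LHS](card_small_ord MN) -[X in (_ ^ X)%N](card_ord d) -card_ffun_on.
  apply: eq_card => r; rewrite !inE; apply/ffun_onP/forallP => rM i; have := rM i; by rewrite inE.
have sizeE : (size Z = \sum_(r : {ffun 'I_d -> 'I_P}) count (fun z => rho z == r) Z)%N.
  rewrite -sum1_size (partition_big rho xpredT)//=.
  by apply: eq_bigr => r _; rewrite sum1_count.
rewrite goodE [X in (_ + X)%N]big_mkcond /= sizeE -big_split /=.
have -> : (m * P ^ d = \sum_(r : {ffun 'I_d -> 'I_P}) m)%N.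
  by rewrite sum_nat_const card_ffun !card_ord mulnC.
apply: leq_sum => r _.
(* Since [2N / N = 2], the mesh points in one residue class are a common representative plus
   [2 *: latvec R (q z)], so the bounds on classes apply to the quotients [q z]. *)
pose q (z : 'rV[int]_d) : 'rV[int]_d := \row_i divz (z 0 i - k0 0 i) P%:Z.
have zE z : rho z = r -> z = k0 + \row_i (r i : nat)%:Z + P%:Z *: q z.
  move=> zr; apply/rowP => i; rewrite !mxE -zr ffunE /=.
  have := divz_eq (z 0 i - k0 0 i) P%:Z.
  have := modz_ge0 (z 0 i - k0 0 i) (_ : P%:Z != 0) => /(_ _)/gez0_abs.
  by move=> ->; lia.
pose X := map q [seq z <- Z | rho z == r].
have uX : uniq X.
  rewrite map_inj_in_uniq ?filter_uniq ?fset_uniq// => z z'.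
  rewrite !mem_filter => /andP[/eqP/zE zr _] /andP[/eqP/zE zr' _] qq.
  by rewrite zr zr' qq.
have XC z : z \in X ->
    C° (N%:R^-1 *: latvec R (k0 + \row_i (r i : nat)%:Z) + 2 *: latvec R z).
  move=> /mapP[y]; rewrite mem_filter => /andP[/eqP/zE yr]; rewrite in_fset_set// => /set_mem.
  rewrite /latpts /= => /KC; rewrite {1}yr => + ->.
  suff -> : N%:R^-1 *: latvec R (k0 + \row_i0 (r i0 : nat)%:Z + P%:Z *: q y) =
    N%:R^-1 *: latvec R (k0 + \row_i (r i : nat)%:Z) + 2 *: latvec R (q y) by [].
  have PE : P%:Z%:~R = N%:R * 2 :> R by rewrite -pmulrn /P -muln2 natrM.
  apply/rowP => i; rewrite !mxE !intrD intrM PE mulrDr; congr (_ + _).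
  by rewrite -!mulrA mulKf// pnatr_eq0 -lt0n.
have sX : size X = count (fun z => rho z == r) Z by rewrite size_map size_filter.
rewrite -sX; case: ifPn => [/forallP rM|_]; last by rewrite addn0; exact: C_le XC.
by rewrite addn1; apply: small XC.
Qed.

(** Otherwise every class met by a small cube inside [W] has at most [m - 1] points in the interior
    of [C]. Summing over the residue classes then loses a fixed amount of volume, namely that of the
    cube. *)
Lemma class_density (W : set 'rV[R]_d) w :
  rvol C = m%:R * 2 ^+ d -> open W -> W w ->
  exists x (X : seq 'rV[int]_d), [/\ W x, uniq X, size X = m &
    forall z, z \in X -> C° (x + 2 *: latvec R z)].
Proof.
move=> vC oW Ww; apply: contrapT => nX.
have small x X : W x -> uniq X -> (forall z, z \in X -> C° (x + 2 *: latvec R z)) ->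
    (size X < m)%N.
  move=> Wx uX XC; rewrite ltn_neqAle (C_le uX XC) andbT; apply/eqP => sX.
  by apply: nX; exists x, X.
have /interiorP[r r0 rW] : W° w by move: oW; rewrite openE; exact.
have [p pr] := inv_small r0.
suff : rvol C <= m%:R * 2 ^+ d - p.+1%:R^-1 ^+ d.
  by rewrite vC lerDl oppr_ge0 leNgt exprn_gt0// invr_gt0.
apply: (@pow_lim _ (d + d) 0) => [|s /andP[s0 s1]]; first exact: ltr01.
have sD : sym_convex_body (dil s C) by exact: body_dil.
have [e e0 up] := rvol_dil_le_nlat sD.
have se0 : 0 < (1 - s) * e by rewrite mulr_gt0// subr_gt0.
have [M Me] := inv_small se0.
(* The factor [M.+1] makes the mesh [1/N] fine enough for [s], and [M.+1] mesh steps measure exactly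
   [1/(p+1) < r]. The cube, and so the loss, is the same for all [s] and survives the limit. *)
pose N := (p.+1 * M.+1)%N; pose h : R := N%:R^-1.
have N0 : 0 < N%:R :> R by rewrite ltr0n.
have h0 : 0 < h by rewrite invr_gt0.
have hM : M.+1%:R * h = p.+1%:R^-1.
  by rewrite /h /N natrM invfM mulrCA mulfV ?mulr1// pnatr_eq0.
have hse : 0 < h < (1 - s) * e.
  rewrite h0 (le_lt_trans _ Me)// lef_pV2 ?posrE// ler_nat.
  by rewrite /N mulSn leq_addr.
pose k0 : 'rV[int]_d := \row_i Num.floor (w 0 i * N%:R).
have cnt : (nlat h (dil s C) + M.+1 ^ d <= m * N.*2 ^ d)%N.
  apply: (@nlat_class_bound N M.+1 k0).
  - by rewrite /N.
  - by rewrite /N -muln2; clear; nia.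
  - exact: body_latpts_finite.
  - move=> x Cx; rewrite -[x]scale1r -(mulfV (lt0r_neq0 s0)) -scalerA.
    by apply: body_shrink_interior => //; rewrite ltW.
  move=> j X jM uX XC; apply: small uX XC.
  set x := _ *: _; rewrite -(subrK w x) addrC; apply: rW.
  apply/lt_norm_rVP => // i; apply: le_lt_trans pr.
  rewrite -hM !mxE -/h intrD.
  have /andP[f1 f2] := floor_itv (w 0 i * N%:R).
  rewrite [X in _ - X](_ : _ = h * (w 0 i * N%:R)); last first.
    by rewrite mulrC -mulrA mulfV ?mulr1// gt_eqF.
  rewrite -mulrBr normrM gtr0_norm// mulrC ler_pM2r//.
  rewrite intrD in f2; rewrite ler_norml -pmulrn.
  have j1 : (j i)%:R + 1 <= M.+1%:R :> R by rewrite natr1 ler_nat jM.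
  have j0 : 0 <= (j i)%:R :> R by [].
  by apply/andP; split; lra.
have := up s h; rewrite s0 s1 => /(_ isT hse).
rewrite !rvol_dil// mulrA -exprD => /le_trans; apply.
rewrite -hM exprMn_comm; last exact: mulrC.
have -> : m%:R * 2 ^+ d = h ^+ d * (m%:R * (N.*2%:R) ^+ d) :> R.
  by rewrite mulrCA -exprMn -muln2 natrM mulrA mulVf ?mul1r// gt_eqF.
rewrite [X in _ - X]mulrC -mulrBr ler_pM2l ?exprn_gt0// lerBrDr.
by rewrite -!natrX -natrM -natrD ler_nat.
Qed.

End Density.

(** * Combinatorics of the interior lattice points *)

Lemma seq_argmin (T : eqType) (f : T -> int) (X : seq T) : (0 < size X)%N ->
  exists2 z0, z0 \in X & forall z, z \in X -> f z0 <= f z.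
Proof.
elim: X => // x [_ _|y X IH _].
  by exists x; rewrite ?mem_head// => z; rewrite inE => /eqP ->.
have [//|z0 z0X z0min] := IH.
have [xz|zx] := leP (f x) (f z0).
  exists x; first exact: mem_head.
  move=> z; rewrite inE => /predU1P[->//|/z0min]; exact: le_trans.
exists z0; first by rewrite inE z0X orbT.
by move=> z; rewrite inE => /predU1P[->|/z0min//]; exact: ltW.
Qed.

(* A polynomial vanishes at finitely many integers only, so evaluating the
   coordinates at a suitable integer separates finitely many vectors from 0. *)
Lemma separating_functional d (s : seq 'rV[int]_d) :
  exists l : 'rV[int]_d -> int, {morph l : z z' / z - z'} /\
    forall z, z \in s -> z != 0 -> l z != 0.
Proof.
pose p := \prod_(z <- s | z != 0) rVpoly z.
have p0 : p != 0.
  rewrite prodf_seq_neq0; apply/allP => z _; apply/implyP.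
  by apply: contraNneq => z0; rewrite -(rVpolyK z) z0 linear0.
have [k pk] : exists k : int, ~~ root p k.
  apply: contrapT => /forallNP nk.
  have : (size [seq i%:Z | i <- iota 0 (size p)] < size p)%N.
    apply: max_poly_roots p0 _ _; last by rewrite map_inj_uniq ?iota_uniq// => ? ? [].
    by apply/allP => i _; have /negP := nk i; rewrite negbK.
  by rewrite size_map size_iota ltnn.
exists (fun z => (rVpoly z).[k]); split => [z z'|z zs z0].
  by rewrite linearB hornerD hornerN.
apply: contraNneq pk => zk; rewrite /root /p (big_rem z)//= z0 hornerM zk.
by rewrite mul0r.
Qed.

Section InteriorLatticePoints.
Variables (R : realType) (d m : nat) (C : set 'rV[R]_d).
Hypothesis m1 : (0 < m)%N.
Hypothesis sC : sym_convex_body C.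

(** The difference is the midpoint of [x + 2z] and [-(x + 2z')]. *)
Lemma interior_class_sub x z z' : C° (x + 2 *: latvec R z) ->
  C° (x + 2 *: latvec R z') -> C° (latvec R (z - z')).
Proof.
move=> Cz /(interiorN sC) Cz'.
rewrite (_ : latvec R (z - z') = 2^-1 *: (x + 2 *: latvec R z) +
    (1 - 2^-1) *: (- (x + 2 *: latvec R z'))); last first.
  by apply/rowP => i; rewrite !mxE intrB; field.
by apply: interior_convI => //; apply/andP; split; lra.
Qed.

Let S : set 'rV[int]_d := [set z | C° (latvec R z)].
Hypothesis cardS : (S #= `I_(2 * m - 1))%card.

Let finS : finite_set S. Proof. by exists (2 * m - 1)%N. Qed.

Let SN z : S z -> S (- z).
Proof. by rewrite /S /= /latvec map_mxN; exact: interiorN. Qed.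

Let S0 : S 0.
Proof. by rewrite /S /= /latvec map_mx0; exact: interior0. Qed.

Section Functional.
Variable l : 'rV[int]_d -> int.
Hypothesis lB : {morph l : z z' / z - z'}.
Hypothesis l_neq0 : forall z, S z -> z != 0 -> l z != 0.

Let Sp := [seq z <- fset_set S | 0 < l z].

Let mem_Sp z : (z \in Sp) = (0 < l z) && `[< S z >].
Proof.
by rewrite mem_filter in_fset_set.
Qed.

Let l0 : l 0 = 0. Proof. by rewrite -(subrr 0) lB subrr. Qed.

Let lN z : l (- z) = - l z. Proof. by rewrite -sub0r lB l0 sub0r. Qed.

(** The origin, [Sp] and [-Sp] are disjoint parts of [S], which has [2m - 1] elements. *)
Let size_Sp : (size Sp < m)%N.
Proof.
have : (size (0%R :: Sp ++ map -%R Sp) <= size (fset_set S))%N.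
  apply: uniq_leq_size => [|z].
    rewrite /= mem_cat negb_or cat_uniq map_inj_uniq; last exact: oppr_inj.
    rewrite !filter_uniq ?fset_uniq//= andbT mem_Sp l0 ltxx/=; apply/andP; split.
      apply/mapP => -[z]; rewrite mem_Sp => /andP[+ _] /eqP.
      by rewrite eq_sym oppr_eq0 => lz /eqP z0; rewrite z0 l0 ltxx in lz.
    apply/hasPn => _ /mapP[z + ->]; rewrite !mem_Sp lN oppr_gt0 => /andP[lz _].
    by rewrite (lt_gtF lz).
  rewrite in_cons mem_cat in_fset_set// => /or3P[/eqP -> | | ]; first exact/mem_set.
    by rewrite mem_Sp => /andP[_ /asboolP]; exact: mem_set.
  by move=> /mapP[y + ->]; rewrite mem_Sp => /andP[_ /asboolP/SN]; exact: mem_set.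
have -> := card_fset_set cardS.
rewrite /= size_cat size_map; lia.
Qed.

(** Take for [z0] the element of [X] with the least value of [l], and for [Y] the differences of the
    other elements with it. *)
Let diff_Sp x X : uniq X -> (forall z, z \in X -> C° (x + 2 *: latvec R z)) ->
  (0 < size X)%N -> exists Y z0, [/\ uniq Y, size X = (size Y).+1, {subset Y <= Sp} &
    forall y, y \in Y -> z0 + y \in X].
Proof.
move=> uX XC X0; have [z0 z0X z0min] := seq_argmin l X0.
exists [seq z - z0 | z <- rem z0 X], z0; split.
- by rewrite map_inj_uniq ?rem_uniq//; exact: addIr.
- by rewrite size_map size_rem// prednK.
- move=> _ /mapP[z + ->]; rewrite mem_rem_uniq// inE => /andP[/= zz0 zX].
  have Sz : S (z - z0) by apply: interior_class_sub; exact: XC.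
  rewrite mem_Sp; apply/andP; split; last exact/asboolP.
  have := l_neq0 Sz; rewrite subr_eq0 => /(_ zz0); rewrite lB lt_neqAle eq_sym => -> /=.
  by rewrite subr_ge0 z0min.
by move=> _ /mapP[z /mem_rem zX ->]; rewrite addrC subrK.
Qed.

Lemma class_size_le_aux x (X : seq 'rV[int]_d) : uniq X ->
  (forall z, z \in X -> C° (x + 2 *: latvec R z)) -> (size X <= m)%N.
Proof.
move=> uX XC; have [/eqP ->//|X0] := boolP (size X == 0)%N.
rewrite -lt0n in X0; have [Y [z0 [uY -> YS _]]] := diff_Sp uX XC X0.
exact: leq_ltn_trans (uniq_leq_size uY YS) size_Sp.
Qed.

(** For a full class the differences with [z0] exhaust [Sp]. Hence [Sp] is stable under subtracting
    its least element [u], as long as the result is non-zero, and descent on [l] shows that it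
    consists of multiples of [u]. *)
Lemma collinear_aux x (X : seq 'rV[int]_d) : uniq X -> (1 < m)%N -> size X = m ->
  (forall z, z \in X -> C° (x + 2 *: latvec R z)) ->
  exists u, forall z, S z -> exists k : int, z = k *: u.
Proof.
move=> uX m2 sX XC; have X0 : (0 < size X)%N by rewrite sX.
have [Y [z0 [uY sXY YS YX]]] := diff_Sp uX XC X0.
have SpY : {subset Sp <= Y}.
  have [|_ YSp] := uniq_min_size uY YS; last by move=> z; rewrite YSp.
  by move: size_Sp; rewrite -sX sXY ltnS.
have Sp0 : (0 < size Sp)%N by apply: leq_trans (uniq_leq_size uY YS); rewrite -ltnS -sXY sX.
have [u uS umin] := seq_argmin l Sp0; exists u.
have Sp_mul n z : z \in Sp -> l z <= n%:Z -> exists k : int, z = k *: u.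
  elim: n z => [|n IH] z zS lz.
    by move: zS; rewrite mem_Sp ltNge lz.
  have [->|zu] := eqVneq z u; first by exists 1; rewrite scale1r.
  (* Both [z0 + z] and [z0 + u] belong to the class [X]. *)
  have Szu : S (z - u).
    rewrite (_ : z - u = (z0 + z) - (z0 + u)); last by rewrite opprD addrACA subrr add0r.
    by apply: (@interior_class_sub x); apply: XC; apply: YX; exact: SpY.
  have lu : 0 < l u by move: uS; rewrite mem_Sp => /andP[].
  have zuS : z - u \in Sp.
    rewrite mem_Sp lt_neqAle eq_sym l_neq0 ?subr_eq0//= lB subr_ge0 umin//=.
    exact/asboolP.
  have [|k ku] := IH _ zuS; first by rewrite lB; lia.
  by exists (k + 1); rewrite scalerDl scale1r -ku subrK.
have Sp_mul' z : z \in Sp -> exists k : int, z = k *: u.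
  by move=> zS; apply: (Sp_mul `|l z|%N) => //; lia.
move=> z Sz; case: (ltgtP (l z) 0) => lz.
- have [|k zk] := Sp_mul' (- z).
    by rewrite mem_Sp lN oppr_gt0 lz; apply/asboolP; exact: SN.
  by exists (- k); rewrite scaleNr -zk opprK.
- by apply: Sp_mul'; rewrite mem_Sp lz; exact/asboolP.
- have [->|/(l_neq0 Sz)] := eqVneq z 0; last by rewrite lz eqxx.
  by exists 0; rewrite scale0r.
Qed.

End Functional.

Lemma S_functional : exists l : 'rV[int]_d -> int, {morph l : z z' / z - z'} /\
  forall z, S z -> z != 0 -> l z != 0.
Proof.
have [l [lB l0]] := separating_functional (fset_set S); exists l; split => // z Sz.
by apply: l0; rewrite in_fset_set//; exact: mem_set.
Qed.

Lemma class_size_le x (X : seq 'rV[int]_d) : uniq X ->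
  (forall z, z \in X -> C° (x + 2 *: latvec R z)) -> (size X <= m)%N.
Proof. by have [l [lB l0]] := S_functional; exact: (class_size_le_aux lB l0). Qed.

Lemma interior_lattice_collinear x (X : seq 'rV[int]_d) : uniq X -> (1 < m)%N -> size X = m ->
  (forall z, z \in X -> C° (x + 2 *: latvec R z)) ->
  exists u, forall z, C° (latvec R z) -> exists k : int, z = k *: u.
Proof. by have [l [lB l0]] := S_functional; exact: (collinear_aux lB l0). Qed.

End InteriorLatticePoints.

(** * Volume of a cylinder and unimodular matrices *)

(** Both iterated integrals agree on measurable rectangles, hence everywhere. In this order the
    chord direction can be integrated first. *)
Lemma product_measure_ysection d1 d2 (T1 : measurableType d1) (T2 : measurableType d2)
  (R : realType) (m1 : {sigma_finite_measure set T1 -> \bar R})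
  (m2 : {sigma_finite_measure set T2 -> \bar R}) (E : set (T1 * T2)) :
  measurable E -> (m1 \x m2)%E E = (\int[m2]_y m1 (ysection E y))%E.
Proof.
move=> mE; rewrite -[RHS]/((m1 \x^ m2)%E E).
apply: product_measure_unique => // A B mA mB.
exact: product_measure2E.
Qed.

Section LiftVolume.
Variables (R : realType) (n : nat).
Implicit Types (B : set 'rV[R]_n) (c : R) (x : 'rV[R]_n.+1).

Definition row_init x : 'rV[R]_n := \row_j x 0 (lift ord_max j).

Definition row_tail x : 'rV[R]_n := \row_j x 0 (lift ord0 j).

Definition cylinder B (a : 'rV[R]_n -> R) c :=
  [set x | B (row_init x) /\ `|x 0 ord_max - a (row_init x)| <= c].

(** Here the axis is the first coordinate, the one that [lebesgue_tuple] splits off. The sections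
    along it are intervals of length [2c] over [B] and empty elsewhere. *)
Lemma vol_tail_cylinder B (a : 'rV[R]_n -> R) c :
  0 <= c -> measurable (tset B) ->
  measurable (tset [set x | B (row_tail x) /\ `|x 0 ord0 - a (row_tail x)| <= c]) ->
  vol [set x | B (row_tail x) /\ `|x 0 ord0 - a (row_tail x)| <= c] =
  ((2 * c)%:E * vol B)%E.
Proof.
move=> c0 mB; set L := [set x | _] => mL; rewrite /vol /=.
have [nu ->] := lebesgue_tuple_measure R n; rewrite /pushforward.
set E := _ @^-1` _.
have mE : measurable E.
  rewrite -[E]setTI; apply: (measurable_cons measurable_fst measurable_snd) => //.
rewrite product_measure_ysection//.
have EE y : ysection E y = if `[< B (\row_i tnth y i) >] then
    `[a (\row_i tnth y i) - c, a (\row_i tnth y i) + c]%classic else set0.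
  have tailE (r : R) : row_tail (\row_i tnth [tuple of r :: y] i) = \row_i tnth y i.
    by apply/rowP => j; rewrite !mxE tnthS.
  rewrite ysectionE predeqE => r; rewrite /E /= /L /= tailE mxE tnth0 /=.
  case: asboolP => By; last by split=> // -[].
  rewrite /= in_itv /= ler_norml; split=> [[_ /andP[? ?]]|/andP[? ?]].
    by apply/andP; split; lra.
  by split=> //; apply/andP; split; lra.
rewrite (eq_integral (fun y => ((2 * c)%:E * (\1_(tset B) y)%:E)%E)); last first.
  move=> y _; rewrite EE indicE; case: asboolP => By.
    rewrite mem_set// mule1.
    apply: etrans (@lebesgue_measure_itv R `[a (\row_i tnth y i) - c, a (\row_i tnth y i) + c]) _.
    rewrite /= lte_fin.
    case: ltP => [_|ca]; first by rewrite -EFinB; congr EFin; lra.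
    by congr EFin; lra.
  by rewrite memNset// mule0 measure0.
rewrite ge0_integralZl//.
- by rewrite integral_indic// setIT.
- by apply/measurable_EFinP; exact: measurable_indic.
by rewrite lee_fin mulr_ge0.
Qed.

(** A permutation of the coordinates is unimodular and brings the last one to the front. *)
Lemma rvol_cylinder B a c : 0 <= c -> sym_convex_body B ->
  sym_convex_body (cylinder B a c) -> rvol (cylinder B a c) = 2 * c * rvol B.
Proof.
move=> c0 sB sL.
pose p : 'S_n.+1 := lift_perm ord0 ord_max 1%g.
have uP (q : 'S_n.+1) : perm_mx q \in @unitmx int n.+1 by exact: unitmx_perm.
have realP (q : 'S_n.+1) : realmx R (perm_mx q) = perm_mx q.
  by apply/matrixP => i j; rewrite !mxE; case: (_ == _).
have pE x j : (x *m realmx R (perm_mx p^-1)) 0 j = x 0 (p j).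
  by rewrite realP -col_permE mxE.
pose L := [set x | B (row_tail x) /\ `|x 0 ord0 - a (row_tail x)| <= c].
have LE : [set x | L (x *m realmx R (perm_mx p^-1))] = cylinder B a c.
  rewrite predeqE => x; rewrite /L /cylinder /= pE lift_perm_id.
  rewrite (_ : row_tail _ = row_init x)//.
  by apply/rowP => j; rewrite [LHS]mxE pE [RHS]mxE lift_perm_lift perm1.
have sL' : sym_convex_body L.
  rewrite (_ : L = [set x | cylinder B a c (x *m realmx R (perm_mx p))]).
    by apply: body_mulmx => //; exact: realmx_unit.
  rewrite predeqE => x; rewrite -LE /= -mulmxA -map_mxM -perm_mxM mulgV perm_mx1.
  by rewrite map_mx1 mulmx1.
rewrite -LE rvol_mulmx// /rvol vol_tail_cylinder//; [|exact: body_measurable..].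
by rewrite rvolE.
Qed.

Lemma lift_setE B a c : @lift_set R n.+1 B (fun y => a y - c) (fun y => a y + c) =
  cylinder B a c.
Proof.
have insubE (j : 'I_n) : insub (val (lift ord_max j)) = Some j :> option 'I_n.
  by rewrite (_ : val (lift ord_max j) = val j) ?valK//; exact: lift_max.
rewrite predeqE => x; split.
  move=> [y [t [-> By /andP[ta at_]]]].
  have yE : row_init (@row_rcons R n.+1 y t) = y.
    by apply/rowP => j; rewrite !mxE insubE.
  rewrite /cylinder /= yE; split=> //.
  rewrite mxE insubF /= ?ltnn// ler_norml; apply/andP; split; lra.
rewrite /cylinder /= ler_norml => -[Bx /andP[? ?]].
exists (row_init x), (x 0 ord_max); split=> //; last by apply/andP; split; lra.
apply/rowP => i; rewrite [RHS]mxE; case: (unliftP ord_max i) => [j ->|->].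
  by rewrite insubE /= mxE.
by rewrite insubF /= ?ltnn.
Qed.

End LiftVolume.

(** * Unimodular maps as integer matrices *)

Section UnimodularMatrices.
Variables (R : realType) (d : nat).

Lemma latticeP (x : 'rV[R]_d) : lattice x <-> exists z, x = latvec R z.
Proof.
split=> [xZ|[z ->] i]; last by rewrite latvecE; exact: intr_int.
exists (map_mx Num.floor x); apply/rowP => i; by rewrite !mxE floorK.
Qed.

Lemma latvec_row (A : 'M[int]_d) i : latvec R (row i A) = row i (realmx R A).
Proof. by apply/rowP => j; rewrite !mxE. Qed.

Lemma latvec_delta i : latvec R (delta_mx 0 i : 'rV_d) = delta_mx 0 i.
Proof. by apply/rowP => j; rewrite !mxE; case: (_ && _). Qed.

(** The images of the unit vectors are lattice vectors and form the rows of [A]; lattice preimages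
    of the unit vectors form the rows of an integer left inverse. *)
Lemma unimodularP (phi : {linear 'rV[R]_d -> 'rV[R]_d}) : unimodular phi <->
  exists2 A : 'M[int]_d, A \in unitmx & forall x, phi x = x *m realmx R A.
Proof.
split=> [uphi|[A uA phiA]]; last first.
  rewrite /unimodular predeqE => x; split=> [[_ /latticeP[z ->] <-]|/latticeP[z ->]].
    by rewrite phiA -latvecM; apply/latticeP; eexists.
  exists (latvec R (z *m invmx A)); first by apply/latticeP; eexists.
  by rewrite phiA -latvecM mulmxKV.
have latE i : lattice (delta_mx 0 i : 'rV[R]_d).
  by apply/latticeP; exists (delta_mx 0 i); rewrite latvec_delta.
have /choice[F FE] : forall i, exists z, phi (delta_mx 0 i) = latvec R z.
  by move=> i; apply/latticeP; rewrite -uphi; exists (delta_mx 0 i).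
have /choice[G GE] : forall i, exists z, phi (latvec R z) = delta_mx 0 i.
  by move=> i; have := latE i; rewrite -uphi => -[_ /latticeP[z ->]]; exists z.
pose A := \matrix_i F i; pose B := \matrix_i G i.
have phiA x : phi x = x *m realmx R A.
  rewrite -mul_rV_lin1; congr (_ *m _); apply/row_matrixP => i.
  by rewrite -latvec_row rowK -FE rowE mul_rV_lin1.
exists A => //; have BA1 : B *m A = 1%:M; last by have [] := mulmx1_unit BA1.
apply/row_matrixP => i; rewrite row_mul rowK; apply: (@latvec_inj R).
by rewrite latvecM -phiA GE row1 latvec_delta.
Qed.

End UnimodularMatrices.

(* The Smith normal form of a row vector u makes u a multiple of a row of a
   unimodular matrix. *)
Lemma row_unimodular n (u : 'rV[int]_n.+1) :
  exists2 A : 'M[int]_n.+1, A \in unitmx & exists c : int, u = (c *: delta_mx 0 ord_max) *m A.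
Proof.
have [L _ [A uA [s _ ->]]] := int_Smith_normal_form u.
(* The Smith form has its entry in column 0; the transposition moves it to column [ord_max]. *)
exists (tperm_mx ord0 ord_max *m A).
  by rewrite unitmx_mul unitmx_perm.
exists (L 0 0 * s`_0); rewrite mulmxA; congr (_ *m _).
apply/rowP => j; rewrite -scalemxAl -rowE !mxE big_ord1 !mxE.
rewrite -mulr_natr mulrA; congr (_ * _).
by rewrite tpermR.
Qed.

(** * Chords of the body *)

Section Fibers.
Variables (R : realType) (d : nat) (C : set 'rV[R]_d).
Hypothesis sC : sym_convex_body C.
Implicit Types (x v : 'rV[R]_d) (t : R).

(** The number [g] is the supremum of the parameters at which the ray is in [C]. It is finite by
    boundedness and attained by closedness; below it, points are interior as convex combinations
    with the interior point [x]. *)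
Lemma ray_exit x v : C° x -> v != 0 -> exists g, [/\ 0 < g,
  forall t, 0 <= t -> C (x + t *: v) <-> t <= g &
  forall t, 0 <= t < g -> C° (x + t *: v)].
Proof.
move=> Cx v0; have vn : 0 < `|v| by rewrite normr_gt0.
pose T := [set t | 0 <= t /\ C (x + t *: v)].
have [M M0 CM] := body_bounded sC.
have /interiorP[e e0 eC] := Cx.
have eT : T (e / (2 * `|v|)).
  split; first by rewrite divr_ge0 ?mulr_ge0// ltW.
  apply: eC; rewrite normrZ gtr0_norm ?divr_gt0 ?mulr_gt0//.
  by rewrite invfM mulrA mulfVK ?gt_eqF//; lra.
have ubT : has_ubound T.
  exists ((M + `|x|) / `|v|) => t [t0 /CM xM]; rewrite ler_pdivlMr//.
  rewrite -[t]ger0_norm// -normrZ -(addKr x (t *: v)) addrC.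
  by rewrite (le_trans (ler_normB _ _))// lerD2r.
have supT : has_sup T by split=> //; exists (e / (2 * `|v|)).
set g := sup T; have g0 : 0 < g.
  by apply: lt_le_trans (ub_le_sup ubT eT); rewrite divr_gt0 ?mulr_gt0.
have conv_lt t t' : 0 <= t < t' -> C (x + t' *: v) -> C° (x + t *: v).
  move=> /andP[t0 tt'] Ct'; have t'0 : 0 < t' by exact: le_lt_trans tt'.
  have -> : x + t *: v = (1 - t / t') *: x + (1 - (1 - t / t')) *: (x + t' *: v).
    rewrite subKr scalerDr scalerA mulfVK ?gt_eqF// addrA -scalerDl subrK scale1r //.
  apply: interior_conv => //; rewrite subr_gt0 ltr_pdivrMr// mul1r tt'/=.
  by rewrite gerBl divr_ge0// ltW.
have lt_g t : 0 <= t < g -> C° (x + t *: v).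
  move=> /andP[t0 tg].
  have tg0 : 0 < g - t by rewrite subr_gt0.
  have [t' [_ Ct'] tt'] := sup_adherent tg0 supT.
  by apply: (conv_lt t t') => //; rewrite t0 -[t](subKr g).
exists g; split=> // t t0; split; first by move=> Ct; apply: ub_le_sup.
rewrite le_eqVlt => /predU1P[->|tg]; last by apply: interior_subset; apply: lt_g; rewrite t0.
apply: contrapT => nC.
have : (~` C)° (x + g *: v).
  have : open (~` C) by rewrite openC; exact: body_closed.
  by rewrite openE; exact.
move=> /interiorP[e' e'0 e'C].
(* A parameter just below [g]: its point is in [C], yet closer than [e'] to the supposedly excluded
   end. *)
pose t' := Num.max 0 (g - e' / (2 * `|v|)).
have de : 0 < e' / (2 * `|v|) by rewrite divr_gt0 ?mulr_gt0.
have t'g : 0 <= t' < g by rewrite le_max lexx/= gt_max g0 ltrBlDr ltrDl.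
apply: (e'C ((t' - g) *: v)); last first.
  by rewrite -addrA -scalerDl [g + _]addrC subrK; apply: interior_subset; exact: lt_g.
have t'g' : `|t' - g| <= e' / (2 * `|v|).
  have : g - e' / (2 * `|v|) <= t' by rewrite le_max lexx orbT.
  by case/andP: t'g => _ ? ?; rewrite ler_norml; apply/andP; split; lra.
rewrite normrZ (le_lt_trans (ler_wpM2r _ t'g'))// invfM mulrA mulfVK ?gt_eqF//; lra.
Qed.

Lemma fiber_itv x v : C° x -> v != 0 -> exists f g, [/\ f < 0 < g,
  forall t, C (x + t *: v) <-> f <= t <= g &
  forall t, f < t < g -> C° (x + t *: v)].
Proof.
move=> Cx v0; have [g [g0 gC gI]] := ray_exit Cx v0.
have [|f [f0 fC fI]] := @ray_exit x (- v) Cx; first by rewrite oppr_eq0.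
exists (- f), g; split=> [|t|t /andP[ft tg]].
- by rewrite oppr_lt0 f0.
- have [t0|t0] := leP 0 t.
    by rewrite gC//; split=> [->|/andP[]//]; rewrite andbT; lra.
  rewrite -[t *: v]opprK -scalerN -scaleNr fC; last by rewrite oppr_ge0 ltW.
  by split=> [?|/andP[? ?]]; [apply/andP; split|]; lra.
have [t0|t0] := leP 0 t; first by apply: gI; rewrite t0.
by rewrite -[t *: v]opprK -scalerN -scaleNr; apply: fI; apply/andP; split; lra.
Qed.

End Fibers.

Section FiberLength.
Variables (R : realType) (n m : nat) (C : set 'rV[R]_n.+1).
Hypothesis m2 : (1 < m)%N.
Hypothesis sC : sym_convex_body C.
Hypothesis C_le : forall x (X : seq 'rV[int]_n.+1), uniq X ->
  (forall z, z \in X -> C° (x + 2 *: latvec R z)) -> (size X <= m)%N.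
Hypothesis vC : rvol C = m%:R * 2 ^+ n.+1.
Let u : 'rV[int]_n.+1 := delta_mx 0 ord_max.
Let e : 'rV[R]_n.+1 := delta_mx 0 ord_max.
Hypothesis axis : forall z, C° (latvec R z) -> exists k : int, z = k *: u.

Let e0 : e != 0.
Proof. by apply/eqP => /rowP/(_ ord_max)/eqP; rewrite !mxE !eqxx oner_eq0. Qed.

Let latvecZ (k : int) : latvec R (k *: u) = k%:~R *: e.
Proof. by apply/rowP => j; rewrite !mxE intrM; case: (_ && _). Qed.

Let Zu_inj : injective (fun k : int => k *: u).
Proof.
by move=> k k' /rowP/(_ ord_max); rewrite !mxE !eqxx !mulr1.
Qed.

(** A longer chord would have [m + 1] interior points at spacing 2, all in one class. *)
Lemma fiber_length_le x f g :
  (forall t, f < t < g -> C° (x + t *: e)) -> g - f <= 2 * m%:R.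
Proof.
move=> Cfg; rewrite leNgt; apply/negP => fg.
(* Half of the excess length is left free at either end. *)
pose t1 := f + (g - f - 2 * m%:R) / 2.
have := @C_le (x + t1 *: e) [seq (k : int) *: u | k <- [seq i%:Z | i <- iota 0 m.+1]].
rewrite map_inj_uniq// map_inj_uniq ?iota_uniq; last by move=> ? ? [].
rewrite !size_map size_iota ltnn => h; have : false; last by [].
apply: h => // _ /mapP[_ /mapP[i + ->] ->]; rewrite mem_iota /= add0n ltnS => im.
rewrite latvecZ scalerA -addrA -scalerDl; apply: Cfg.
have : i%:R <= m%:R :> R by rewrite ler_nat.
have : 0 <= i%:R :> R by [].
rewrite -pmulrn /t1; move: (m%:R : R) (i%:R : R) fg => M I fg I0 IM.
by apply/andP; split; lra.
Qed.

Lemma line_conv x a b c : a <= b <= c -> C (x + a *: e) -> C (x + c *: e) ->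
  C (x + b *: e).
Proof.
move=> /andP[ab bc] Ca Cc; have [ac|ca] := ltP a c; last first.
  by have -> : b = a by lra.
have ca0 : 0 < c - a by rewrite subr_gt0.
have -> : x + b *: e = ((c - b) / (c - a)) *: (x + a *: e) +
    (1 - (c - b) / (c - a)) *: (x + c *: e).
  apply/rowP => i; rewrite !mxE; field; by rewrite gt_eqF.
apply: body_conv => //; apply/andP; split.
  by rewrite divr_ge0// ?subr_ge0// ltW.
by rewrite ler_pdivrMr// mul1r; lra.
Qed.

(** On a chord shorter than [2m] some interior point has a class with at most [m - 1] points on its
    line. This persists on the open set [W], where density provides a full class, which [axis]
    confines to the line. *)
Lemma fiber_length_ge x f g : f < g ->
  (forall t, C (x + t *: e) <-> f <= t <= g) ->
  (forall t, f < t < g -> C° (x + t *: e)) -> 2 * m%:R <= g - f.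
Proof.
move=> fltg fgC fgI; rewrite leNgt; apply/negP => fg.
have m2R : 2 <= m%:R :> R by rewrite (ler_nat _ 2).
(* For [t1] strictly between [lo] and [hi], the point at [t1] is interior, while [t1 - 2 < f] and
   [t1 + 2 (m - 1) > g] leave the chord. *)
pose lo := Num.max f (g - 2 * m%:R + 2).
pose hi := Num.min g (f + 2).
have lohi : lo < hi.
  rewrite /lo /hi gt_max !lt_min fltg/=; apply/and3P; split; lra.
pose t1 := (lo + hi) / 2.
have flo : f <= lo by rewrite le_max lexx.
have glo : g - 2 * m%:R + 2 <= lo by rewrite le_max lexx orbT.
have hig : hi <= g by rewrite ge_min lexx.
have hif : hi <= f + 2 by rewrite ge_min lexx orbT.
pose c : R := 2 * (m%:R - 1).
pose W := [set y | C° y] `&` ([set y | ~ C (y + (- 2) *: e)] `&` [set y | ~ C (y + c *: e)]).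
have oW : open W.
  have shift w : open [set y | ~ C (y + w)].
    have oC : open (~` C) by rewrite openC; exact: body_closed.
    rewrite openE => y /= nCy; have : (~` C)° (y + w) by move: oC; rewrite openE; exact.
    move=> /interiorP[r r0 rC]; apply/interiorP; exists r => // z zr.
    by rewrite /= addrAC; exact: rC.
  by apply: openI; [exact: open_interior|apply: openI; exact: shift].
have Wx : W (x + t1 *: e).
  rewrite /W /=; split; first by apply: fgI; apply/andP; split; rewrite /t1; lra.
  by split; rewrite -addrA -scalerDl => /fgC; rewrite /t1 /c => /andP[? ?]; lra.
(* The chord through y meets the class of y in at most m - 1 points. *)
have [y [X [[Cy [nC1 nC2]] uX sX XC]]] := class_density sC C_le vC oW Wx.
(* Otherwise adding 0 would give a class of [m + 1] points, as [y] itself is interior. *)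
have X0 : 0 \in X.
  apply: contraT => X0; have := @C_le y (0 :: X); rewrite /= X0 uX sX ltnn => h.
  have : false; last by []; apply: h => // z; rewrite inE => /predU1P[->|]; last exact: XC.
  by rewrite /latvec map_mx0 scaler0 addr0.
have : (size X <= size [seq (k : int) *: u | k <- [seq i%:Z | i <- iota 0 m.-1]])%N.
  apply: uniq_leq_size => // z zX.
  (* Being a multiple of the axis vector, [z] moves [y] along its chord; the excluded points at [-2]
     and [2 (m - 1)] leave only the multiples from 0 to [m - 2]. *)
  have Sz : C° (latvec R (z - 0)) by apply: (interior_class_sub sC) (XC _ zX) (XC _ X0).
  have [k zk] := axis Sz; rewrite subr0 in zk.
  apply/mapP; exists k => //.
  have Ck : C (y + (2 * k%:~R) *: e).
    by rewrite -scalerA -latvecZ -zk; apply: interior_subset; exact: XC.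
  have Cy0 : C (y + 0 *: e) by rewrite scale0r addr0; exact: interior_subset.
  have k0 : 0 <= k.
    rewrite leNgt; apply/negP => k0; apply: nC1; apply: line_conv Ck Cy0.
    have : k%:~R <= (-1)%:~R :> R by rewrite ler_int; move: k0; clear; lia.
    by rewrite mulrN1z => ?; apply/andP; split; lra.
  have km : k < (m.-1)%:Z.
    rewrite ltNge; apply/negP => km; apply: nC2; apply: line_conv Cy0 Ck.
    have : (m.-1)%:Z%:~R <= k%:~R :> R by rewrite ler_int.
    rewrite -pmulrn -subn1 natrB ?(ltnW m2)// => ?.
    by rewrite /c; apply/andP; split; lra.
  apply/mapP; exists `|k|%N; last by rewrite gez0_abs.
  by rewrite mem_iota /=; move: k0 km; clear; lia.
by rewrite !size_map size_iota sX; move: m2; clear; lia.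
Qed.

Lemma fiber_center x : C° x -> exists a,
  (forall t, C (x + t *: e) <-> `|t - a| <= m%:R) /\
  (forall t, `|t - a| < m%:R -> C° (x + t *: e)).
Proof.
move=> Cx; have [f [g [/andP[f0 g0] fgC fgI]]] := fiber_itv sC Cx e0.
have le := fiber_length_le fgI.
have ge := fiber_length_ge (lt_trans f0 g0) fgC fgI.
exists ((f + g) / 2); split=> t.
  rewrite fgC ler_norml; split=> /andP[? ?]; apply/andP; split; lra.
by rewrite ltr_norml => /andP[? ?]; apply: fgI; apply/andP; split; lra.
Qed.

End FiberLength.

(** * Linear extension of an odd affine function given near the origin *)

Section LinearExtension.
Variables (R : realType) (n : nat) (D : set 'rV[R]_n) (f : 'rV[R]_n -> R).
Variable r : R.
Hypothesis r0 : 0 < r.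
Hypothesis rD : forall y, `|y| < r -> D y.
Hypothesis fN : forall y, D y -> f (- y) = - f y.
Hypothesis f_conv : forall y y' s, D y -> D y' -> 0 <= s <= 1 ->
  f (s *: y + (1 - s) *: y') = s * f y + (1 - s) * f y'.

Let D0 : D 0. Proof. by apply: rD; rewrite normr0. Qed.

Let f0 : f 0 = 0.
Proof. by have := fN D0; rewrite oppr0 => ?; lra. Qed.

Let fZ y s : D y -> 0 <= s <= 1 -> f (s *: y) = s * f y.
Proof.
by move=> Dy s01; have := f_conv Dy D0 s01; rewrite f0 scaler0 mulr0 !addr0.
Qed.

Let rho (y : 'rV[R]_n) : R := r / (`|y| + 1).

Let rho0 y : 0 < rho y.
Proof. by rewrite divr_gt0// ltr_wpDl. Qed.

Let D_small y c : 0 < c <= rho y -> D (c *: y).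
Proof.
move=> /andP[c0 cr]; apply: rD; rewrite normrZ gtr0_norm//.
apply: (@le_lt_trans _ _ (rho y * `|y|)); first by rewrite ler_wpM2r.
by rewrite /rho mulrAC ltr_pdivrMr ?ltr_wpDl// ltr_pM2l// ltrDl.
Qed.

(* The scaling factor [rho y] keeps the argument of f in the domain D. *)
Definition lin_ext y := f (rho y *: y) / rho y.

(** The quotient does not depend on the scale: the smaller of [c] and [rho y] is the larger one
    times a factor in [[0, 1]], where [f] is homogeneous. *)
Lemma lin_ext_eq y c : 0 < c -> D (c *: y) -> lin_ext y = f (c *: y) / c.
Proof.
move=> c0 Dc; have Dr : D (rho y *: y) by apply: D_small; rewrite rho0 lexx.
have [cr|rc] := leP c (rho y).
  have -> : c *: y = (c / rho y) *: (rho y *: y).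
    by rewrite scalerA mulfVK ?gt_eqF.
  rewrite fZ//; first by rewrite /lin_ext;
    move: (rho y) (rho0 y) (f _) => q q0 F; field; rewrite !gt_eqF.
  by apply/andP; split; [rewrite divr_ge0// ltW|rewrite ler_pdivrMr ?mul1r].
have E : rho y *: y = (rho y / c) *: (c *: y).
  by rewrite scalerA mulfVK ?gt_eqF.
rewrite /lin_ext {1}E (fZ Dc)//; first by
  move: (rho y) (rho0 y) (f _) => q q0 F; field; rewrite !gt_eqF.
by apply/andP; split; [rewrite divr_ge0// ltW|rewrite ler_pdivrMr ?mul1r// ltW].
Qed.

Lemma lin_extE y : D y -> lin_ext y = f y.
Proof. by move=> Dy; rewrite (@lin_ext_eq y 1) ?scale1r ?divr1. Qed.

Lemma lin_ext_linear (k : R) (y y' : 'rV[R]_n) :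
  lin_ext (k *: y + y') = k * lin_ext y + lin_ext y'.
Proof.
have extD w w' : lin_ext (w + w') = lin_ext w + lin_ext w'.
  pose c := Num.min (rho w) (rho w') / 2.
  have m0 : 0 < Num.min (rho w) (rho w') by rewrite lt_min !rho0.
  have mw : Num.min (rho w) (rho w') <= rho w by rewrite ge_min lexx.
  have mw' : Num.min (rho w) (rho w') <= rho w' by rewrite ge_min lexx orbT.
  have c0 : 0 < c by rewrite divr_gt0.
  have h01 : 0 <= (2^-1 : R) <= 1 by apply/andP; split; lra.
  (* With [b] at most half of both scales, [2b w] and [2b w'] are still in [D], and [b (w + w')] is
     their midpoint. *)
  pose b := Num.min c (rho (w + w')).
  have b0 : 0 < b by rewrite lt_min c0 rho0.
  have bc : b <= c by rewrite ge_min lexx.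
  have bD : D (b *: (w + w')) by apply: D_small; rewrite b0 ge_min lexx orbT.
  have Dwb : D ((2 * b) *: w) by apply: D_small; rewrite /c in bc; apply/andP; split; lra.
  have Dwb' : D ((2 * b) *: w') by apply: D_small; rewrite /c in bc; apply/andP; split; lra.
  rewrite (@lin_ext_eq (w + w') b)// (@lin_ext_eq w (2 * b)) ?mulr_gt0//.
  rewrite (@lin_ext_eq w' (2 * b)) ?mulr_gt0//.
  have -> : b *: (w + w') = 2^-1 *: ((2 * b) *: w) + (1 - 2^-1) *: ((2 * b) *: w').
    by apply/rowP => i; rewrite !mxE; field.
  by rewrite f_conv//; field; rewrite gt_eqF.
have extN w : lin_ext (- w) = - lin_ext w.
  have := extD w (- w); rewrite subrr lin_extE// f0 => h.
  by apply/eqP; rewrite -addr_eq0 addrC -h.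
have extZ_gt0 t w : 0 < t -> lin_ext (t *: w) = t * lin_ext w.
  move=> t0; pose c := Num.min (rho (t *: w)) (rho w / t).
  have c0 : 0 < c by rewrite lt_min rho0 divr_gt0.
  have Dc : D (c *: (t *: w)) by apply: D_small; rewrite c0 ge_min lexx.
  rewrite (lin_ext_eq c0 Dc) (@lin_ext_eq w (c * t)) ?mulr_gt0 -?scalerA//.
  by field; rewrite !gt_eqF.
rewrite extD; congr (_ + _); case: (ltgtP k 0) => [k0|k0|->].
- by rewrite -[k *: y]opprK -scaleNr extN extZ_gt0 ?oppr_gt0// mulNr opprK.
- exact: extZ_gt0.
- by rewrite scale0r mul0r lin_extE.
Qed.

End LinearExtension.

(** * From constant chord length to a cylinder over the projection *)

Section Cylinder.
Variables (R : realType) (n m : nat) (C : set 'rV[R]_n.+1).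
Hypothesis m0 : (0 < m)%N.
Hypothesis sC : sym_convex_body C.
Let e : 'rV[R]_n.+1 := delta_mx 0 ord_max.
Hypothesis fibers : forall x, C° x -> exists a,
  (forall t, C (x + t *: e) <-> `|t - a| <= m%:R) /\
  (forall t, `|t - a| < m%:R -> C° (x + t *: e)).

Definition row_cons_max (T : nmodType) (y : 'rV[T]_n) (t : T) : 'rV[T]_n.+1 :=
  \row_i oapp (y 0) t (unlift ord_max i).

Lemma row_init_cons y t : row_init (row_cons_max y t) = y :> 'rV[R]_n.
Proof. by apply/rowP => j; rewrite !mxE liftK. Qed.

Lemma row_consK (x : 'rV[R]_n.+1) : row_cons_max (row_init x) (x 0 ord_max) = x.
Proof.
apply/rowP => i; rewrite mxE; case: (unliftP ord_max i) => [j ->|->] //=.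
by rewrite mxE.
Qed.

Lemma row_cons_addZ (y : 'rV[R]_n) (t t' : R) :
  row_cons_max y t + t' *: e = row_cons_max y (t + t').
Proof.
apply/rowP => i; rewrite !mxE; case: (unliftP ord_max i) => [j ->|->] /=.
  by rewrite eq_sym (negbTE (neq_lift _ _)) mulr0 addr0.
by rewrite eqxx mulr1.
Qed.

Lemma row_cons_lin (y y' : 'rV[R]_n) (t t' s s' : R) :
  s *: row_cons_max y t + s' *: row_cons_max y' t' =
  row_cons_max (s *: y + s' *: y') (s * t + s' * t').
Proof. by apply/rowP => i; rewrite !mxE; case: (unlift _ _) => [j|] //=; rewrite !mxE. Qed.

Lemma row_init_lin (x x' : 'rV[R]_n.+1) (s s' : R) :
  row_init (s *: x + s' *: x') = s *: row_init x + s' *: row_init x'.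
Proof. by apply/rowP => j; rewrite !mxE. Qed.

Lemma row_initZ (x : 'rV[R]_n.+1) (s : R) : row_init (s *: x) = s *: row_init x.
Proof. by apply/rowP => j; rewrite !mxE. Qed.

Lemma row_initN (x : 'rV[R]_n.+1) : row_init (- x) = - row_init x.
Proof. by apply/rowP => j; rewrite !mxE. Qed.

Lemma row_init_norm (x : 'rV[R]_n.+1) : `|row_init x| <= `|x|.
Proof. by apply/le_norm_rVP => // i; rewrite mxE; exact: coord_le_norm. Qed.

Lemma row_init_continuous : continuous (@row_init R n).
Proof.
move=> x; apply/(@cvgrPdist_lt _ _ _ _ (nbhs_filter x)) => r r0; apply/nbhs_ballP.
exists r => //= y; rewrite -ball_normE /=; apply: le_lt_trans.
rewrite (_ : row_init x - row_init y = row_init (x - y)); first exact: row_init_norm.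
by apply/rowP => j; rewrite !mxE.
Qed.

Let B := @row_init R n @` C.

Lemma base_body : sym_convex_body B.
Proof.
split; last by move=> _ [x Cx <-]; exists (- x); rewrite ?row_initN//; exact: sym_bodyN.
split.
- apply: continuous_compact; last by case: sC => -[].
  by apply: continuous_subspaceT; exact: row_init_continuous.
- move=> _ _ l /set_mem[x Cx <-] /set_mem[x' Cx' <-]; apply/mem_set.
  exists (l%:num *: x + (1 - l%:num) *: x'); last exact: row_init_lin.
  by apply: body_conv => //; apply/andP; split.
exists 0; have [r r0 rC] := sym_body0 sC; apply/interiorP; exists r => // y yr.
exists (row_cons_max y 0); rewrite ?row_init_cons ?add0r//; apply: rC.
apply/lt_norm_rVP => // i; rewrite mxE.
case: (unliftP ord_max i) => [j|] _ /=; last by rewrite normr0.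
exact: le_lt_trans (coord_le_norm _ _) yr.
Qed.

(** A slightly larger multiple [(1 + t) y] is still in the projection; shrinking a point of [C]
    above it by [1 / (1 + t)] gives an interior point above [y]. *)
Lemma base_interior y : B° y -> exists2 x, C° x & row_init x = y.
Proof.
move=> /interiorP[r r0 rB]; pose t := r / (2 * (`|y| + 1)).
have y1 : 0 < 2 * (`|y| + 1) by rewrite mulr_gt0// ltr_wpDl.
have t0 : 0 < t by rewrite divr_gt0.
have [|x Cx xy] := rB (t *: y).
  rewrite normrZ gtr0_norm// /t mulrAC ltr_pdivrMr// ltr_pM2l//.
  by have := normr_ge0 y; lra.
have t1 : 0 < 1 + t by lra.
exists ((1 + t)^-1 *: x).
  by apply: body_shrink_interior => //; rewrite invr_ge0 ltW//= invf_lt1// ltrDl.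
by rewrite row_initZ xy -{1}[y]scale1r -scalerDl scalerA mulVf ?scale1r ?gt_eqF.
Qed.

Lemma base_fiber y : B° y -> exists a,
  (forall t, C (row_cons_max y t) <-> `|t - a| <= m%:R) /\
  (forall t, `|t - a| < m%:R -> C° (row_cons_max y t)).
Proof.
move=> /base_interior[x /fibers[a [aC aI]] <-].
have E t : row_cons_max (row_init x) t = x + (t - x 0 ord_max) *: e.
  by rewrite -[X in _ = X + _](row_consK x) row_cons_addZ subrKC.
exists (x 0 ord_max + a); split=> t; rewrite E opprD addrA; first exact: aC.
exact: aI.
Qed.

(** The open chord above [z] has half-length [m >= 1] around [a], so it contains the integer height
    [Num.floor a]. The resulting interior lattice point of [C] must be on the axis. *)
Lemma base_lattice z :
  (forall z, C° (latvec R z) -> exists k : int, z = k *: delta_mx 0 ord_max) ->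
  B° (latvec R z) -> z = 0.
Proof.
move=> axis /base_fiber[a [_ aI]].
have [|k kE] := axis (row_cons_max z (Num.floor a)).
  rewrite (_ : latvec R _ = row_cons_max (latvec R z) (Num.floor a)%:~R).
    apply: aI; have /andP[f1 f2] := floor_itv a; rewrite intrD in f2.
    have m1 : 1 <= m%:R :> R by rewrite ler1n.
    by rewrite ltr_norml; apply/andP; split; lra.
  by apply/rowP => i; rewrite !mxE; case: (unlift _ _) => [j|] //=; rewrite mxE.
apply/rowP => j; have /rowP/(_ (lift ord_max j)) := kE.
by rewrite !mxE liftK /= eq_sym (negbTE (neq_lift _ _)) mulr0.
Qed.

(** Let [f y] be the height of the midpoint of the chord above [y]. Convex combinations of upper
    ends and of lower ends are in [C], and chords all have length [2m], so [f] is affine; by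
    symmetry it is odd, hence the restriction of a linear function. *)
Lemma body_is_cylinder : exists a : {linear 'rV[R]_n -> R^o}, C = cylinder B a m%:R.
Proof.
have sB := base_body.
have mge0 : 0 <= m%:R :> R by [].
have /choice[f fP] : forall y, exists a, B° y ->
    forall t, C (row_cons_max y t) <-> `|t - a| <= m%:R.
  move=> y; have [/base_fiber[a [aC _]]|nB] := pselect (B° y); first by exists a.
  by exists 0 => /nB.
have ends y : B° y -> C (row_cons_max y (f y + m%:R)) /\ C (row_cons_max y (f y - m%:R)).
  by move=> By; rewrite !fP// [f y + _]addrC addrK addrAC subrr add0r normrN ger0_norm.
have f_uniq y c : B° y -> C (row_cons_max y (c + m%:R)) -> C (row_cons_max y (c - m%:R)) ->
    f y = c.
  move=> By /fP-/(_ By) + /fP-/(_ By); rewrite !ler_norml => /andP[? ?] /andP[? ?].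
  by lra.
have f_conv y y' s : B° y -> B° y' -> 0 <= s <= 1 ->
    f (s *: y + (1 - s) *: y') = s * f y + (1 - s) * f y'.
  move=> By By' s01; apply: f_uniq; first exact: interior_convI.
    rewrite (_ : _ + m%:R = s * (f y + m%:R) + (1 - s) * (f y' + m%:R)); last by ring.
    by rewrite -row_cons_lin; apply: body_conv => //; case: (ends _ By); case: (ends _ By').
  rewrite (_ : _ - m%:R = s * (f y - m%:R) + (1 - s) * (f y' - m%:R)); last by ring.
  by rewrite -row_cons_lin; apply: body_conv => //; case: (ends _ By); case: (ends _ By').
have consN y t : row_cons_max (- y) (- t) = - row_cons_max y t :> 'rV[R]_n.+1.
  by apply/rowP => i; rewrite !mxE; case: (unlift _ _) => [j|] //=; rewrite mxE.
have fN y : B° y -> f (- y) = - f y.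
  move=> By; have [h1 h2] := ends y By; apply: f_uniq; first exact: interiorN.
    by rewrite -[m%:R]opprK -opprD consN; exact: sym_bodyN.
  by rewrite -opprD consN; exact: sym_bodyN.
have /interiorP[r r0 rB] := interior0 sB.
have rB' y : `|y| < r -> B° y.
  move=> yr; apply/interiorP; exists (r - `|y|); first by rewrite subr_gt0.
  move=> z zr; rewrite -[_ + _]add0r; apply: rB.
  by rewrite (le_lt_trans (ler_normD _ _))//; lra.
pose g : 'rV[R]_n -> R^o := lin_ext f r.
have gE y : B° y -> g y = f y by exact: (lin_extE r0 rB' fN f_conv).
have glin : linear g by exact: (lin_ext_linear r0 rB' fN f_conv).
pose ga := GRing.isLinear.Build R 'rV[R]_n R^o _ g glin.
pose a : {linear 'rV[R]_n -> R^o} := HB.pack g ga.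
have gZ s y : g (s *: y) = s * g y by exact: (linearZZ a s y).
have sBi y s : B y -> 0 <= s < 1 -> B° (s *: y) by exact: body_shrink_interior.
(* The chords are known only over the interior of [B]; points over its boundary are reached by
   shrinking with [s < 1] and letting [s] tend to 1. *)
exists a; rewrite predeqE => x; split=> [Cx|[Bx xa]].
  have Bx : B (row_init x) by exists x.
  split=> //; apply: (@pow_lim _ 1 0) => [|s /andP[s0 s1]]; first exact: ltr01.
  have s01 : 0 <= s < 1 by rewrite ltW.
  have : C (s *: x) by apply: body_shrink => //; rewrite !ltW.
  rewrite -(row_consK (s *: x)) row_initZ (fP _ (sBi _ _ Bx s01)) -gE ?gZ; last exact: sBi.
  by rewrite mxE -mulrBr normrM gtr0_norm.
apply: body_lim => // s /[dup] s01 /andP[s0 s1].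
rewrite -(row_consK (s *: x)) row_initZ (fP _ (sBi _ _ Bx s01)) -gE ?gZ; last exact: sBi.
rewrite mxE -mulrBr normrM ger0_norm// (le_trans (ler_wpM2l s0 xa))//.
by rewrite ler_piMl// ltW.
Qed.

End Cylinder.

Lemma lattice_cardE (R : realType) d k (K : set 'rV[R]_d) :
  (K° `&` @lattice R d #= `I_k)%card = ([set z | K° (latvec R z)] #= `I_k)%card.
Proof.
have -> : K° `&` @lattice R d = @latvec R d @` [set z | K° (latvec R z)].
  rewrite predeqE => x; split=> [[Kx /latticeP[z xz]]|[z Kz <-]].
    by exists z; rewrite /= -?xz.
  by split=> //; apply/latticeP; exists z.
have cI : (@latvec R d @` [set z | K° (latvec R z)] #= [set z | K° (latvec R z)])%card.
  by apply: inj_card_eq => z z' _ _; exact: latvec_inj.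
by apply/idP/idP; apply: card_eq_trans => //; rewrite card_eq_sym.
Qed.

Lemma mulmx_preimage_card (R : realType) d k (K : set 'rV[R]_d) (A : 'M[int]_d) :
  A \in unitmx -> ([set z | K° (latvec R z)] #= `I_k)%card ->
  ([set z | [set x | K (x *m realmx R A)]° (latvec R z)] #= `I_k)%card.
Proof.
move=> uA; apply: card_eq_trans; rewrite card_eq_sym.
rewrite (_ : [set z | K° (latvec R z)] = (fun z => z *m A) @`
    [set z | [set x | K (x *m realmx R A)]° (latvec R z)]).
  by apply: inj_card_eq => z z' _ _; exact: (can_inj (mulmxK uA)).
rewrite interior_mulmx ?realmx_unit// predeqE => z; split=> [Kz|[z' Kz' <-]].
  by exists (z *m invmx A); rewrite /= -?latvecM mulmxKV.
by rewrite /= latvecM.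
Qed.

(** * The two directions of the equivalence *)

Section Equality.
Variables (R : realType) (n m : nat) (C : set 'rV[R]_n.+1).
Hypothesis m2 : (1 < m)%N.
Hypothesis sC : sym_convex_body C.
Hypothesis cardC : ([set z | C° (latvec R z)] #= `I_(2 * m - 1))%card.

Let m1 : (0 < m)%N. Proof. exact: ltnW. Qed.

(** A unimodular change of basis puts all interior lattice points on the last axis. The new body is
    a cylinder over its projection [B], and [2m] times the volume of [B] equals [m 2^(n+1)]. *)
Lemma extremal_lift : rvol C = m%:R * 2 ^+ n.+1 ->
  exists B : set 'rV[R]_n, extremal B /\ @cylindrical_lifting R n.+1 m C B.
Proof.
move=> vC.
have C_le := class_size_le m1 sC cardC.
(* Density in the whole space yields one full class, enough for collinearity. *)
have [x [X [_ uX sX XC]]] := class_density sC C_le vC openT (I : setT (0 : 'rV[R]_n.+1)).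
have [u uP] := interior_lattice_collinear m1 sC cardC uX m2 sX XC.
have [A uA [c uE]] := row_unimodular u.
have uM := realmx_unit R uA.
pose C' := [set x | C (x *m realmx R A)].
have sC' : sym_convex_body C' by exact: body_mulmx.
have vC' : rvol C' = m%:R * 2 ^+ n.+1 by rewrite rvol_mulmx.
have C'_le := class_size_le m1 sC' (mulmx_preimage_card uA cardC).
have axis z : C'° (latvec R z) -> exists k : int, z = k *: delta_mx 0 ord_max.
  rewrite interior_mulmx//= -latvecM => /uP[k zk]; exists (k * c).
  apply: (can_inj (mulmxK uA)); rewrite zk uE -!scalemxAl scalerA.
  by [].
have fib := @fiber_center _ _ _ _ m2 sC' C'_le vC' axis.
have [a C'E] := body_is_cylinder sC' fib.
set B := _ @` C' in C'E.
have sB : sym_convex_body B by exact: base_body.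
exists B; split.
  split; first split=> //.
    rewrite lattice_cardE (_ : [set z | _] = [set 0]); first exact: card_set1.
    rewrite predeqE => z; split=> [Bz|->]; first exact: (base_lattice m1 sC' fib axis Bz).
    by rewrite /= /latvec map_mx0; exact: interior0.
  have := vC'; rewrite C'E rvol_cylinder//; last by rewrite -C'E.
  rewrite exprS [2 * _]mulrC -!mulrA => /mulfI; rewrite pnatr_eq0 -lt0n => /(_ m1)/mulfI vB.
  by rewrite rvolE// vB ?natrX// pnatr_eq0.
pose phi := mulmxr (realmx R A) : 'rV[R]_n.+1 -> 'rV[R]_n.+1.
exists phi, a; split; first by apply/unimodularP; exists A.
rewrite lift_setE -C'E predeqE => y; split=> [Cy|[w C'w <-]//].
by exists (y *m invmx (realmx R A)); rewrite /C' /= mulmxKV.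
Qed.

(** Undoing the unimodular map preserves the volume and leaves a cylinder of half-height [m]. *)
Lemma lift_rvol (B : set 'rV[R]_n) : sym_convex_body B ->
  @cylindrical_lifting R n.+1 m C B -> rvol C = 2 * m%:R * rvol B.
Proof.
move=> sB [phi [a [/unimodularP[A uA phiA]]]]; rewrite lift_setE => CE.
have uM := realmx_unit R uA.
have LE : cylinder B a m%:R = [set x | C (x *m realmx R A)].
  rewrite CE predeqE => x; split=> [Lx|/= [y Ly]]; first by exists x.
  by rewrite phiA => /(can_inj (mulmxK uM)) <-.
by rewrite -(rvol_mulmx uA sC) -LE rvol_cylinder// LE; exact: body_mulmx.
Qed.

End Equality.

Theorem theorem1 (R : realType) (d m : nat) (hd : (2 <= d)%N) (hm : (2 <= m)%N)
    (C : set 'rV[R]_d) (hC : sym_convex_body_pts (2 * m - 1) C) :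
  vol C = (m * 2 ^ d)%:R%:E <->
  exists B : set 'rV[R]_d.-1, extremal B /\ cylindrical_lifting m C B.
Proof.
case: d hd C hC => // n _ C [sC]; rewrite lattice_cardE => cardC.
have -> : (vol C = (m * 2 ^ n.+1)%:R%:E) = (rvol C = m%:R * 2 ^+ n.+1).
  rewrite rvolE// natrM natrX; apply/propext; split=> [[]|->] //.
split=> [|[B [[[sB _] vB] lB]]]; first exact: extremal_lift.
rewrite (lift_rvol sC sB lB); have [->] : (rvol B)%:E = (2 ^ n)%:R%:E by rewrite -rvolE.
by rewrite natrX exprS mulrCA mulrA.
Qed.
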